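(* Let $n\ge1$ and fix $\hbar\in\mathbb C\setminus\{1/k:k\in\mathbb N,k\ge1\}$. For all $s,s'\in\{1,\dots,1+n\}$ the algebras $\mathcal A(M_{\mathrm{red}}^{(s)})$ with product $\star^{(s)}_{\mathrm{red},\hbar}$ and $\mathcal A(M_{\mathrm{red}}^{(s')})$ with product $\star^{(s')}_{\mathrm{red},\hbar}$ are isomorphic as unital Fréchet algebras (i.e. there is a unital algebra isomorphism between them which is a homeomorphism).
   Context: For $s\in\{1,\dots,1+n\}$ let $\nu_k=+1$ for $0\le k\le s-1$ and $\nu_k=-1$ for $s\le k\le n$. On $\mathbb C^{1+n}$ with standard coordinates $z^0,\dots,z^n$ put $J^{(s)}=\sum_{k=0}^n\nu_k z^k\bar z^k$, $Z^{(s)}=(J^{(s)})^{-1}(\{1\})$ and $M^{(s)}_{\mathrm{red}}=Z^{(s)}/U(1)$, identified with the open complex submanifold $\{[\rho]: J^{(s)}(\rho)>0\}$ of $\mathbb{CP}^n$. Let $\hat J^{(s)}(\xi,\eta)=\sum_{k=0}^n\nu_k\xi^k\eta^k$ on $\mathbb C^{1+n}\times\mathbb C^{1+n}$, $\hat Z^{(s)}=(\hat J^{(s)})^{-1}(\{1\})$ and $\hat M^{(s)}_{\mathrm{red}}=\hat Z^{(s)}/\mathbb C^*$, where $\alpha\in\mathbb C^*$ acts by $(\xi,\eta)\mapsto(\alpha\xi,\alpha^{-1}\eta)$; this is a complex manifold, identified with the open subset $\{([\xi],[\eta]):\hat J^{(s)}(\xi,\eta)\neq0\}$ of $\mathbb{CP}^n\times\mathbb{CP}^n$.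 Let $\Delta_{\mathrm{red}}^{(s)}:M^{(s)}_{\mathrm{red}}\to\hat M^{(s)}_{\mathrm{red}}$, $[\rho]\mapsto[(\rho,\bar\rho)]$ for $\rho\in Z^{(s)}$. Then $\mathcal A(M^{(s)}_{\mathrm{red}})=\{\hat g\circ\Delta^{(s)}_{\mathrm{red}}:\hat g\in\mathcal O(\hat M^{(s)}_{\mathrm{red}})\}$ with the Fréchet topology of locally uniform convergence of the (unique) holomorphic extensions $\hat g$ on $\hat M^{(s)}_{\mathrm{red}}$. For multiindices $P,Q\in\mathbb N_0^{1+n}$ with $|P|=|Q|$ let $b^{(s)}_{P,Q;\mathrm{red}}\in\mathcal A(M^{(s)}_{\mathrm{red}})$ be $[\rho]\mapsto\rho^P\bar\rho^Q$ for $\rho\in Z^{(s)}$; these functions span a dense subalgebra $\mathcal P(M^{(s)}_{\mathrm{red}})$. Writing $a_m(\hbar)=\prod_{j=0}^{m-1}(1-j\hbar)$ and $\mathrm{sgn}^{(s)}(T)=\prod_{k=0}^n\nu_k^{T_k}$, the product $\star^{(s)}_{\mathrm{red},\hbar}$ on $\mathcal P(M^{(s)}_{\mathrm{red}})$ is the well-defined associative bilinear product with $$b^{(s)}_{P,Q;\mathrm{red}}\star^{(s)}_{\mathrm{red},\hbar}b^{(s)}_{R,S;\mathrm{red}}=\sum_{T=0}^{\min\{Q,R\}}\mathrm{sgn}^{(s)}(T)\,\hbar^{|T|}\frac{a_{|Q+R-T|}(\hbar)}{a_{|Q|}(\hbar)\,a_{|R|}(\hbar)}\,T!\binom QT\binom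 RT\,b^{(s)}_{P+R-T,Q+S-T;\mathrm{red}}$$ (sum over multiindices $T$ with $0\le T\le\min\{Q,R\}$ elementwise). This product is continuous and $\star^{(s)}_{\mathrm{red},\hbar}$ also denotes its unique continuous extension to $\mathcal A(M^{(s)}_{\mathrm{red}})$; the constant function $1$ is the unit. *)

(* Defs.v *)
From HB Require Import structures.
From mathcomp Require Import all_boot all_order all_algebra.
From mathcomp Require Import all_classical all_reals all_analysis.
From mathcomp Require Import complex.
Set Implicit Arguments.
Unset Strict Implicit.
Unset Printing Implicit Defensive.
Import Order.TTheory GRing.Theory Num.Theory.
Import numFieldNormedType.Exports.
Local Open Scope classical_set_scope.
Local Open Scope ring_scope.
Local Open Scope quotient_scope.

(* [R[i]] packaged as a numClosedFieldType, so that it inherits the norm and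
   topology of an abstract numeric field. *)
Definition cplx (R : realType) : numClosedFieldType := R[i].

Section Reduction.
Variables (R : realType) (n s : nat).
Local Notation C := (cplx R).
Local Notation V := 'rV[C]_n.+1.

Definition nu (k : 'I_n.+1) : C := if (k < s)%N then 1 else -1.

Definition J (z : V) : C := \sum_k nu k * z ord0 k * Num.conj (z ord0 k).

Definition hatJ (x : V * V) : C := \sum_k nu k * x.1 ord0 k * x.2 ord0 k.

Definition Z : set V := [set z | J z = 1].

Definition hatZ : set (V * V) := [set x | hatJ x = 1].

Definition U1_rel : rel Z :=
  fun x y => `[< exists2 u : C, `|u| = 1 & \val y = u *: \val x >].

Definition Cstar_rel : rel hatZ :=
  fun x y => `[< exists2 a : C, a != 0 &
                   \val y = (a *: (\val x).1, a^-1 *: (\val x).2) >].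

Lemma U1_rel_refl : reflexive U1_rel.
Proof. by move=> x; apply/asboolP; exists 1; rewrite ?normr1 ?scale1r. Qed.

Lemma U1_rel_sym : symmetric U1_rel.
Proof.
suff H x y : U1_rel x y -> U1_rel y x by move=> x y; apply/idP/idP; apply: H.
move=> /asboolP[u u1 yE]; apply/asboolP; exists u^-1.
  by rewrite normfV u1 invr1.
have u0 : u != 0 by rewrite -normr_gt0 u1 ltr01.
by rewrite yE scalerA mulVf ?scale1r.
Qed.

Lemma U1_rel_trans : transitive U1_rel.
Proof.
move=> y x z /asboolP[u u1 yE] /asboolP[v v1 zE]; apply/asboolP.
by exists (v * u); rewrite ?normrM ?u1 ?v1 ?mulr1// zE yE scalerA.
Qed.

Canonical U1_equiv := EquivRel U1_rel U1_rel_refl U1_rel_sym U1_rel_trans.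

Lemma Cstar_rel_refl : reflexive Cstar_rel.
Proof.
move=> x; apply/asboolP; exists 1; rewrite ?oner_neq0// invr1 !scale1r.
by case: (\val x).
Qed.

Lemma Cstar_rel_sym : symmetric Cstar_rel.
Proof.
suff H x y : Cstar_rel x y -> Cstar_rel y x.
  by move=> x y; apply/idP/idP; apply: H.
move=> /asboolP[a a0 yE]; apply/asboolP; exists a^-1; first by rewrite invr_eq0.
rewrite yE /= !scalerA invrK mulVf// mulfV// !scale1r.
by case: (\val x).
Qed.

Lemma Cstar_rel_trans : transitive Cstar_rel.
Proof.
move=> y x z /asboolP[a a0 yE] /asboolP[b b0 zE]; apply/asboolP.
exists (b * a); first by rewrite mulf_neq0.
by rewrite zE yE /= !scalerA invfM.
Qed.

Canonical Cstar_equiv :=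
  EquivRel Cstar_rel Cstar_rel_refl Cstar_rel_sym Cstar_rel_trans.

Definition Mred : Type := {eq_quot U1_rel}.
HB.instance Definition _ := Quotient.on Mred.
HB.instance Definition _ := Choice.on Mred.

Definition hatMred : Type := quotient_topology {eq_quot Cstar_rel}.
HB.instance Definition _ := Quotient.on hatMred.
HB.instance Definition _ := Topological.on hatMred.

(* [Delta] sends the class of [rho] to the class of [(rho, conj rho)]; it is
   defined by choosing a representative, see [Delta_pi]. *)
Lemma conj_in_hatZ (z : Z) :
  (\val z, map_mx Num.conj (\val z)) \in hatZ.
Proof.
have : J (\val z) = 1 by have := valP z; rewrite inE.
by rewrite inE /hatZ /= => <-; apply: eq_bigr => k _; rewrite mxE.
Qed.

Definition conj_pair (z : Z) : hatZ :=
  @exist _ (fun x => x \in hatZ) _ (conj_in_hatZ z).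

Definition Delta (m : Mred) : hatMred := \pi_hatMred (conj_pair (repr m)).

Lemma repr_Mred (z : Z) :
  exists2 u : C, `|u| = 1 & \val (repr (\pi_Mred z)) = u *: \val z.
Proof.
have : z = repr (\pi_Mred z) %[mod Mred] by rewrite reprK.
by move=> /eqmodP/asboolP.
Qed.

Lemma Delta_pi (z : Z) : Delta (\pi_Mred z) = \pi_hatMred (conj_pair z).
Proof.
have [u u1 zE] := repr_Mred z.
have u0 : u != 0 by rewrite -normr_gt0 u1 ltr01.
apply/esym/eqmodP/asboolP; exists u => //=; rewrite zE; congr (_, _).
have uV : Num.conj u = u^-1.
  by apply: (mulfI u0); rewrite mulfV// -normCK u1 expr1n.
by apply/matrixP => i j; rewrite !mxE rmorphM /= uV.
Qed.

(* The homeomorphism of [hatMred] with the open subset [hatJ <> 0] of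
   CP^n x CP^n maps the class of [(xi, eta)] to the pair of lines
   ([xi], [eta]); its inverse rescales a pair of homogeneous coordinates into
   [hatZ]. *)
Definition hatMred_of_hom (x : V * V) : option hatMred :=
  omap (\pi_hatMred) (insub ((hatJ x)^-1 *: x.1, x.2) : option hatZ).

Definition affine (i : 'I_n.+1) (t : 'rV[C]_n) : V :=
  \row_k oapp (t ord0) 1 (unlift i k).

Definition in_chart (i j : 'I_n.+1) (g : hatMred -> C)
    (t : 'rV[C]_n * 'rV[C]_n) : C :=
  oapp g 0 (hatMred_of_hom (affine i t.1, affine j t.2)).

(* Holomorphy is complex differentiability in the product of the standard
   affine charts of CP^n x CP^n. *)
Definition holomorphic (g : hatMred -> C) : Prop :=
  forall i j (t : 'rV[C]_n * 'rV[C]_n),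
    hatJ (affine i t.1, affine j t.2) != 0 -> differentiable (in_chart i j g) t.

Definition analytic : {pred Mred -> C} :=
  mem [set f | exists2 g, holomorphic g & f = g \o Delta].

Lemma analyticP f :
  reflect (exists2 g, holomorphic g & f = g \o Delta) (f \in analytic).
Proof.
by apply: (iffP idP) => [|h]; [rewrite /analytic inE | rewrite /analytic inE].
Qed.

Lemma in_chart_near (G : V * V -> C) (g : hatMred -> C) i j
    (t : 'rV[C]_n * 'rV[C]_n) :
  (forall x : hatZ, g (\pi_hatMred x) = G (\val x)) ->
  hatJ (affine i t.1, affine j t.2) != 0 ->
  in_chart i j g t =
    G ((hatJ (affine i t.1, affine j t.2))^-1 *: affine i t.1, affine j t.2).
Proof.
move=> gG t0; rewrite /in_chart /hatMred_of_hom /=.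
case: insubP => [x _ xE|] /=; first by rewrite gG xE.
move=> /negP[]; rewrite inE /hatZ /= -[RHS](mulVf t0) [in RHS]/hatJ mulr_sumr.
by apply: eq_bigr => k _; rewrite /= !mxE mulrCA !mulrA.
Qed.

Lemma near_eq_differentiable (U W : normedModType C) (f g : U -> W) (x : U) :
  (\near x, f x = g x) -> differentiable f x -> differentiable g x.
Proof.
move=> fg df; have fgx := nbhs_singleton fg.
have gE : g \o shift x = cst (g x) + 'd f x +o_ 0 id.
  apply/eqaddoP => e e0.
  have /eqaddoP/(_ _ e0) := diff_locally df.
  have fg0 : \forall y \near 0, f (y + x) = g (y + x).
    rewrite (near_shift x) sub0r; apply: filterS fg => y /=.
    by rewrite subrK.
  by apply: filterS2 fg0 => y /= fgy; rewrite !fctE /= fgy fgx.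
have dg := diff_unique (diff_continuous df) gE.
apply/diff_locallyP; rewrite dg; split; last exact: gE.
exact: (diff_continuous df).
Qed.

Lemma affine_differentiable (U : normedModType C) i k (f : U -> 'rV[C]_n) x :
  differentiable f x -> differentiable (fun t => affine i (f t) ord0 k) x.
Proof.
move=> df; rewrite /affine; under eq_fun do rewrite mxE.
case: (unlift i k) => [k'|] /=; last exact: differentiable_cst.
apply: (@differentiable_comp _ _ _ _ f (fun v : 'rV[C]_n => v ord0 k')) => //.
exact: differentiable_coord.
Qed.

Lemma prod_differentiable (U : normedModType C) (F : 'I_n.+1 -> U -> C) x :
  (forall k, differentiable (F k) x) ->
  differentiable (fun t => \prod_k F k t) x.
Proof.
move=> dF; elim: (index_enum _) => [|k r IHr].
  by under eq_fun do rewrite big_nil; exact: differentiable_cst.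
by under eq_fun do rewrite big_cons; exact: differentiableM.
Qed.

Lemma sum_differentiable (U : normedModType C) (F : 'I_n.+1 -> U -> C) x :
  (forall k, differentiable (F k) x) ->
  differentiable (fun t => \sum_k F k t) x.
Proof.
move=> dF; elim: (index_enum _) => [|k r IHr].
  by under eq_fun do rewrite big_nil; exact: differentiable_cst.
by under eq_fun do rewrite big_cons; exact: differentiableD.
Qed.

Lemma pow_differentiable (U : normedModType C) (F : U -> C) m x :
  differentiable F x -> differentiable (fun t => F t ^+ m) x.
Proof.
move=> dF; elim: m => [|m IHm].
  by under eq_fun do rewrite expr0; exact: differentiable_cst.
by under eq_fun do rewrite exprS; exact: differentiableM.
Qed.

Lemma fst_differentiable (U W : normedModType C) (p : U * W) :
  differentiable fst p.
Proof. by apply: (@linear_differentiable _ _ _ fst) => q; exact: cvg_fst. Qed.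

Lemma snd_differentiable (U W : normedModType C) (p : U * W) :
  differentiable snd p.
Proof. by apply: (@linear_differentiable _ _ _ snd) => q; exact: cvg_snd. Qed.

Lemma hatJ_chart_differentiable i j (t : 'rV[C]_n * 'rV[C]_n) :
  differentiable (fun t => hatJ (affine i t.1, affine j t.2)) t.
Proof.
apply: sum_differentiable => k /=.
apply: differentiableM; last exact/affine_differentiable/snd_differentiable.
apply: differentiableM; first exact: differentiable_cst.
exact/affine_differentiable/fst_differentiable.
Qed.

Lemma near_hatJ_neq0 i j (t : 'rV[C]_n * 'rV[C]_n) :
  hatJ (affine i t.1, affine j t.2) != 0 ->
  \near t, hatJ (affine i t.1, affine j t.2) != 0.
Proof.
move=> t0.
have /differentiable_continuous h := hatJ_chart_differentiable i j t.
exact: (cvgr_neq0 _ h).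
Qed.

Lemma holomorphic_cst (c : C) : holomorphic (cst c).
Proof.
move=> i j t t0.
apply: (@near_eq_differentiable _ _ (cst c)); last exact: differentiable_cst.
apply: filterS (near_hatJ_neq0 t0) => u u0.
by rewrite (@in_chart_near (cst c)).
Qed.

Lemma holomorphic_lin (a : C) (g h : hatMred -> C) :
  holomorphic g -> holomorphic h -> holomorphic (a *: g + h).
Proof.
move=> hg hh i j t t0.
have -> : in_chart i j (a *: g + h) = a *: in_chart i j g + in_chart i j h.
  apply/funext => u; rewrite /in_chart !fctE /=.
  by case: hatMred_of_hom => [y|] /=; rewrite ?fctE// scaler0 addr0.
by apply: differentiableD; [apply: differentiableZ; exact: hg | exact: hh].
Qed.

Lemma analytic_submod : submod_closed analytic.
Proof.
split; first by apply/analyticP; exists (cst 0) => //; exact: holomorphic_cst.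
move=> a _ _ /analyticP[g hg ->] /analyticP[h hh ->]; apply/analyticP.
by exists (a *: g + h); first exact: holomorphic_lin.
Qed.

HB.instance Definition _ :=
  GRing.isSubmodClosed.Build C (Mred -> C) analytic analytic_submod.

Record algA := AlgA { alg_fun :> Mred -> C; _ : alg_fun \in analytic }.

HB.instance Definition _ := [isSub for alg_fun].
HB.instance Definition _ := [Choice of algA by <:].
HB.instance Definition _ := [SubChoice_isSubLmodule of algA by <:].

Lemma extension_ex (f : algA) : exists2 g, holomorphic g & alg_fun f = g \o Delta.
Proof. exact/analyticP/(valP f). Qed.

(* The holomorphic extension is unique by the identity theorem, so that the
   choice made by [cid2] is immaterial. As [hatMred] is locally compact, locally
   uniform convergence is uniform convergence on compact sets. *)
Definition extension (f : algA) : {family compact, hatMred -> C} :=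
  s2val (cid2 (extension_ex f)).

HB.instance Definition _ := Topological.copy algA (initial_topology extension).

Lemma alg_one_subproof : (cst 1 : Mred -> C) \in analytic.
Proof. by apply/analyticP; exists (cst 1) => //; exact: holomorphic_cst. Qed.

Definition alg_one : algA := AlgA alg_one_subproof.

Definition midx := {ffun 'I_n.+1 -> nat}.

Definition mdeg (P : midx) : nat := (\sum_k P k)%N.

Definition mono (P : midx) (z : V) : C := \prod_k z ord0 k ^+ P k.

Definition bfun (P Q : midx) (m : Mred) : C :=
  mono P (\val (repr m)) * Num.conj (mono Q (\val (repr m))).

Lemma monoZ P (a : C) z : mono P (a *: z) = a ^+ mdeg P * mono P z.
Proof.
rewrite /mono /mdeg expr_sum -big_split /=.
by apply: eq_bigr => k _; rewrite mxE exprMn.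
Qed.

Lemma mono_conj P z : mono P (map_mx Num.conj z) = Num.conj (mono P z).
Proof.
rewrite /mono rmorph_prod; apply: eq_bigr => k _.
by rewrite mxE rmorphXn.
Qed.

Lemma bfun_pi P Q (z : Z) : mdeg P = mdeg Q ->
  bfun P Q (\pi_Mred z) = mono P (\val z) * Num.conj (mono Q (\val z)).
Proof.
move=> PQ; rewrite /bfun; have [u u1 ->] := repr_Mred z.
rewrite !monoZ PQ rmorphM rmorphXn /= mulrACA -exprMn.
by rewrite -normCK u1 !expr1n mul1r.
Qed.

Lemma bfun_analytic P Q : mdeg P = mdeg Q -> bfun P Q \in analytic.
Proof.
move=> PQ; apply/analyticP.
pose G (x : V * V) : C := mono P x.1 * mono Q x.2.
pose g (y : hatMred) := G (\val (repr y)).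
have gG x : g (\pi_hatMred x) = G (\val x).
  have : x = repr (\pi_hatMred x) %[mod hatMred] by rewrite reprK.
  move=> /eqmodP/asboolP[a a0 aE]; rewrite /g aE /G /= !monoZ PQ.
  by rewrite mulrACA exprVn mulfV ?expf_neq0// mul1r.
exists g; last first.
  apply/funext => m; rewrite -[m]reprK /= Delta_pi gG bfun_pi//.
  by rewrite /G /= mono_conj.
move=> i j t t0.
pose H (t : 'rV[C]_n * 'rV[C]_n) := hatJ (affine i t.1, affine j t.2).
apply: (@near_eq_differentiable _ _
  (fun t => G ((H t)^-1 *: affine i t.1, affine j t.2))).
  apply: filterS (near_hatJ_neq0 t0) => u u0.
  by rewrite (in_chart_near gG u0).
apply: differentiableM; apply: prod_differentiable => k /=;
    apply: pow_differentiable; last first.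
  exact/affine_differentiable/snd_differentiable.
under eq_fun do rewrite mxE.
apply: differentiableM; last exact/affine_differentiable/fst_differentiable.
by apply: differentiableV => //; exact: hatJ_chart_differentiable.
Qed.

(* Junk value 0 unless [mdeg P = mdeg Q], see [alg_bE]. *)
Definition alg_b (P Q : midx) : algA := insubd 0 (bfun P Q).

Lemma alg_bE P Q : mdeg P = mdeg Q -> alg_b P Q = bfun P Q :> (Mred -> C).
Proof. by move=> PQ; rewrite -[LHS]/(val _) val_insubd bfun_analytic. Qed.

Definition midx_add (P Q : midx) : midx := [ffun k => P k + Q k]%N.
Definition midx_sub (P Q : midx) : midx := [ffun k => P k - Q k]%N.
Definition midx_fact (P : midx) : nat := (\prod_k (P k)`!)%N.
Definition midx_bin (P Q : midx) : nat := (\prod_k 'C(P k, Q k))%N.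
Definition sgn (P : midx) : C := \prod_k nu k ^+ P k.

(* [below Q R] enumerates the multiindices 0 <= T <= min(Q, R). *)
Definition below (Q R : midx) := {dffun forall k, 'I_(minn (Q k) (R k)).+1}.
Definition midx_of Q R (T : below Q R) : midx := [ffun k => T k : nat].

Definition a_ (hbar : C) (m : nat) : C := \prod_(j < m) (1 - j%:R * hbar).

(* The truncated subtractions below are exact since T <= min(Q, R). *)
Definition star_b (hbar : C) (P Q R S : midx) : algA :=
  \sum_(T : below Q R)
    let T := midx_of T in
    (sgn T * hbar ^+ mdeg T
     * (a_ hbar (mdeg (midx_sub (midx_add Q R) T))
        / (a_ hbar (mdeg Q) * a_ hbar (mdeg R)))
     * (midx_fact T * midx_bin Q T * midx_bin R T)%:R)
    *: alg_b (midx_sub (midx_add P R) T) (midx_sub (midx_add Q S) T).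

(* The linear span of the [alg_b P Q] with |P| = |Q|. *)
Definition polyA : set algA :=
  [set f | exists r : seq (C * (midx * midx)),
     all (fun c => mdeg c.2.1 == mdeg c.2.2) r /\
     f = \sum_(c <- r) c.1 *: alg_b c.2.1 c.2.2].

(* [op] is a continuous extension to [algA] of the bilinear product on [polyA]
   given by [star_b] on generators. *)
Definition is_star (hbar : C) (op : algA -> algA -> algA) : Prop :=
  [/\ forall (c : C) f f' g, polyA f -> polyA f' -> polyA g ->
        op (c *: f + f') g = c *: op f g + op f' g,
      forall (c : C) f g g', polyA f -> polyA g -> polyA g' ->
        op f (c *: g + g') = c *: op f g + op f g',
      forall P Q R S, mdeg P = mdeg Q -> mdeg R = mdeg S ->
        op (alg_b P Q) (alg_b R S) = star_b hbar P Q R S &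
      continuous (fun fg : algA * algA => op fg.1 fg.2)].

(* The unique continuous extension, as a definite description; the zero product
   is the value it would have if such an extension failed to exist uniquely. *)
Definition star (hbar : C) : algA -> algA -> algA :=
  xget (fun _ _ => 0)
    [set op | is_star hbar op /\ forall op', is_star hbar op' -> op' = op].

End Reduction.

Arguments alg_one {R n s}.
Arguments star {R n s}.

(* Main.v *)
Require Import Defs.
From HB Require Import structures.
From mathcomp Require Import all_boot all_order all_algebra.
From mathcomp Require Import all_classical all_reals all_analysis.
From mathcomp Require Import complex.
From mathcomp Require Import ring lra.
Import Order.TTheory GRing.Theory Num.Theory.
Import numFieldNormedType.Exports ComplexField.Normc.
Local Open Scope classical_set_scope.
Local Open Scope ring_scope.
Set Implicit Arguments.
Unset Strict Implicit.
Unset Printing Implicit Defensive.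

(** The map (xi, eta) |-> (xi, eps eta) with eps_k = nu_k nu'_k turns hatJ^(s')
    into hatJ^(s), hence induces a biholomorphic map between the two complexified
    reduced spaces; pulling back holomorphic extensions along it sends b_{P,Q} to
    a sign times b'_{P,Q}, and these signs exactly convert sgn^(s)(T) into
    sgn^(s')(T) in the structure constants. Since [star] is characterised by its
    values on the b_{P,Q} and by continuity, it is transported as well, whether or
    not such a continuous extension exists.

    All of this relies on the uniqueness of the holomorphic extension. As
    holomorphy is only pointwise differentiability, it is obtained from scratch:
    Goursat's bisection gives f a primitive F on squares; F is twice
    differentiable, so that the second derivative test for Re F + e |z|^2 gives the
    maximum principle; applied to F (r / (z - c))^k for all k it yields
    unique continuation in one variable, used along complex lines. *)

(** * Real analysis *)

(** For s different from s' the twist acts on eta alone and does not preserve the locus eta = conj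
    xi, so it gives no map between the reduced spaces themselves: a function can be moved only
    through its extension. Since [extension] is a choice and the topology of [algA] is defined by
    it, the chosen extension of a transported function must be shown to be the pullback of the
    chosen extension; this is where uniqueness enters. One complex derivative is all that is known
    at the start. Replacing f by a primitive normalised at a zero gains a second derivative,
    vanishing of f passes to the primitive along segments, and differentiating at the end returns to
    f. A complex line between two points with hatJ nonzero may still meet hatJ = 0. The freedom to
    rescale xi and eta independently is used to keep the segment between them away from that set. *)

Lemma is_derive_epsP (K : numFieldType) (f : K -> K) (x a : K) :
  is_derive x 1 f a <->
  forall e : K, 0 < e -> exists2 d : K, 0 < d & forall h, `|h| < d ->
    `|f (x + h) - f x - a * h| <= e * `|h|.
Proof.
have quot h : h != 0 -> a - h^-1 *: ((f \o shift x) (h *: 1) - f x) =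
    - (h^-1 * (f (x + h) - f x - a * h)).
  by move=> h0; rewrite /= [h *: 1]mulr1 [h + x]addrC /GRing.scale/=; field.
have bound h e : h != 0 ->
    (`|a - h^-1 *: ((f \o shift x) (h *: 1) - f x)| <= e) =
    (`|f (x + h) - f x - a * h| <= e * `|h|).
  move=> h0; rewrite quot// normrN normrM normfV ler_pdivrMl ?normr_gt0//.
  by rewrite [`|h| * e]mulrC.
split=> [[df dfE] e e0|H].
  have /cvgrPdist_le/(_ _ e0) : h^-1 *: ((f \o shift x) (h *: 1) - f x)
      @[h --> 0^'] --> a by rewrite -dfE; exact: df.
  rewrite near_withinE => -[d /= d0 Hd]; exists d => // h hd.
  have [->|h0] := eqVneq h 0;
    first by rewrite addr0 subrr sub0r mulr0 oppr0 normr0 mulr0.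
  by rewrite -bound//; apply: Hd => //; rewrite /= sub0r normrN.
have c : h^-1 *: ((f \o shift x) (h *: 1) - f x) @[h --> 0^'] --> a.
  apply/cvgrPdist_le => e e0; have [d d0 Hd] := H _ e0.
  rewrite near_withinE; near=> h => h0; rewrite bound//; apply: Hd.
  by near: h; rewrite near_simpl; exists d => //= z /=; rewrite sub0r normrN.
apply: DeriveDef; first by apply/cvg_ex; exists a.
exact: (cvg_lim _ c).
Unshelve. all: by end_near. Qed.

Section RealAnalysis.
Variable R : realType.
Implicit Types (f g df : R -> R) (p q U : R -> R -> R) (x y s t r h k d e D L : R).

(** Fréchet differentiability at a single point, with gradient (a, b). Nothing is asked about how a
    and b depend on the point, which is the setting of Goursat's argument. *)
Definition diff2 p (x y a b : R) : Prop :=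
  forall e : R, 0 < e -> exists2 d : R, 0 < d & forall h k, `|h| < d -> `|k| < d ->
    `|p (x + h) (y + k) - p x y - (a * h + b * k)| <= e * (`|h| + `|k|).

Lemma diff2_x p x y a b : diff2 p x y a b -> is_derive x 1 (p ^~ y) a.
Proof.
move=> H; apply/is_derive_epsP => e /H[d d0 Hd]; exists d => // h hd.
by have := Hd h 0 hd; rewrite normr0 !addr0 mulr0 addr0; exact.
Qed.

Lemma diff2_y p x y a b : diff2 p x y a b -> is_derive y 1 (p x) b.
Proof.
move=> H; apply/is_derive_epsP => e /H[d d0 Hd]; exists d => // h hd.
by have := Hd 0 h; rewrite normr0 !addr0 mulr0 !add0r; exact.
Qed.

(** Intermediate points are described by their distances to both ends, so s and t may come in either
    order and increments of both signs are treated at once. *)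
Lemma MVT_dist f df s t :
  (forall x, `|x - s| <= `|t - s| -> `|x - t| <= `|t - s| ->
     is_derive x 1 f (df x)) ->
  exists c, [/\ `|c - s| <= `|t - s|, `|c - t| <= `|t - s| &
     f t - f s = df c * (t - s)].
Proof.
wlog st : s t / s <= t => [H|] Hd.
  have [/H|/ltW ts] := leP s t; first exact.
  have [|c [c1 c2 c3]] := H t s ts.
    by move=> x; rewrite [`|s - t|]distrC => ? ?; exact: Hd.
  rewrite [`|s - t|]distrC in c1 c2.
  by exists c; split => //; rewrite -opprB c3; ring.
have [| |c] := @MVT_segment R f df s t st.
- move=> x; rewrite in_itv/= => /andP[sx xt]; apply: Hd.
    by rewrite !ger0_norm ?subr_ge0//; lra.
  by rewrite distrC !ger0_norm ?subr_ge0//; lra.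
- apply: derivable_within_continuous => x; rewrite in_itv/= => /andP[sx xt].
  have : is_derive x 1 f (df x); last by case.
  apply: Hd.
    by rewrite !ger0_norm ?subr_ge0//; lra.
  by rewrite distrC !ger0_norm ?subr_ge0//; lra.
rewrite in_itv/= => /andP[sc ct] H; exists c; split => //.
  by rewrite !ger0_norm ?subr_ge0//; lra.
by rewrite distrC !ger0_norm ?subr_ge0//; lra.
Qed.

Lemma antiderivative g r r' : r' < r ->
  (forall x, `|x| < r -> {for x, continuous g}) ->
  exists G, forall x, `|x| < r' -> is_derive x 1 G (g x).
Proof.
move=> rr gc.
exists (fun x => \int[lebesgue_measure]_(t in `[- r', x]) g t) => x.
rewrite ltr_norml => /andP[x1 x2].
have gi : lebesgue_measure.-integrable `[- r', r'] (EFin \o g).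
  apply: continuous_compact_integrable; first exact: segment_compact.
  apply: continuous_in_subspaceT => y; rewrite inE/= in_itv/= => yr.
  by apply: gc; rewrite (le_lt_trans _ rr)// ler_norml.
have gx : {for x, continuous g}.
  by apply: gc; rewrite (lt_trans _ rr)// ltr_norml x1.
have [d1 d2] := continuous_FTC1_closed x2 gi x1 gx.
exact: (DeriveDef d1 (etrans (esym (derive1E _ _)) d2)).
Qed.

(** [P s t n] is meant as a property of the square with lower corner (s, t) and side 2^-n. In each
    coordinate the lower ends do not decrease and the upper ends do not increase, so the supremum of
    the lower ends lies in all the nested intervals. *)
Lemma dyadic_bisection (P : R -> R -> nat -> Prop) :
  P 0 0 0%N ->
  (forall s t n, P s t n -> exists u v : bool,
     P (s + u%:R / 2 ^+ n.+1) (t + v%:R / 2 ^+ n.+1) n.+1) ->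
  exists s0 t0, [/\ 0 <= s0 <= 1, 0 <= t0 <= 1 & forall n, exists s t,
    [/\ P s t n, 0 <= s, s <= s0, s0 <= s + 1 / 2 ^+ n & s + 1 / 2 ^+ n <= 1] /\
    [/\ 0 <= t, t <= t0, t0 <= t + 1 / 2 ^+ n & t + 1 / 2 ^+ n <= 1]].
Proof.
move=> P0 PS.
(* The choice is made for every triple, with a dummy value where no successor is known; [zP] shows
   that the recursion stays where [P] holds. *)
have /choice[w wP] (z : R * R * nat) : exists uv : bool * bool,
    P z.1.1 z.1.2 z.2 -> P (z.1.1 + uv.1%:R / 2 ^+ z.2.+1)
      (z.1.2 + uv.2%:R / 2 ^+ z.2.+1) z.2.+1.
  have [/PS[u [v ?]]|nP] := pselect (P z.1.1 z.1.2 z.2); first by exists (u, v).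
  by exists (true, true).
pose z := fix z n : R * R := if n is m.+1 then
  ((z m).1 + (w (z m, m)).1%:R / 2 ^+ m.+1,
   (z m).2 + (w (z m, m)).2%:R / 2 ^+ m.+1) else (0, 0).
have zP n : P (z n).1 (z n).2 n by elim: n => //= n; exact: (wP (z n, n)).
have key (a : nat -> R) (e : nat -> bool) :
    a 0%N = 0 -> (forall n, a n.+1 = a n + (e n)%:R / 2 ^+ n.+1) ->
    exists s0, forall n, [/\ 0 <= a n, a n <= s0, s0 <= a n + 1 / 2 ^+ n &
                            a n + 1 / 2 ^+ n <= 1].
  move=> a0 aS.
  have half n : 1 / 2 ^+ n = 1 / 2 ^+ n.+1 + 1 / 2 ^+ n.+1 :> R.
    by rewrite exprS invfM; field; rewrite expf_neq0.
  have pos n : 0 < 1 / 2 ^+ n :> R by rewrite divr_gt0// exprn_gt0.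
  have st n : a n <= a n.+1 /\ a n.+1 + 1 / 2 ^+ n.+1 <= a n + 1 / 2 ^+ n.
    rewrite aS; have := pos n.+1; have := half n.
    by case: (e n) => /=; rewrite ?mulr1n ?mulr0n; lra.
  have mono m n : a m <= a (m + n)%N /\
      a (m + n)%N + 1 / 2 ^+ (m + n) <= a m + 1 / 2 ^+ m.
    elim: n => [|n [IH1 IH2]]; first by rewrite addn0.
    by rewrite addnS; have [? ?] := st (m + n)%N; lra.
  have ub m n : a m <= a n + 1 / 2 ^+ n.
    have [mn|/ltnW nm] := leqP m n.
      by have [+ _] := mono m (n - m)%N; rewrite subnKC//; have := pos n; lra.
    by have [_ +] := mono n (m - n)%N; rewrite subnKC//; have := pos m; lra.
  pose A := range a.
  have A0 : has_sup A.
    split; first by exists (a 0%N), 0%N.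
    by exists (a 0%N + 1 / 2 ^+ 0) => _ [m _ <-]; exact: ub.
  exists (sup A) => n; have [m1 m2] := mono 0%N n.
  rewrite add0n a0 expr0 in m1 m2; split; [lra| | |lra].
    by apply: ub_le_sup; [exact: A0.2|exists n].
  by apply: ge_sup; [exact: A0.1|move=> _ [m _ <-]; exact: ub].
have [s0 hs] := key (fun n => (z n).1) _ erefl (fun n => erefl).
have [t0 ht] := key (fun n => (z n).2) _ erefl (fun n => erefl).
exists s0, t0; split.
- by have [_ /=] := hs 0%N; rewrite expr0; lra.
- by have [_ /=] := ht 0%N; rewrite expr0; lra.
move=> n; exists (z n).1, (z n).2.
by have [? ? ? ?] := hs n; have [? ? ? ?] := ht n.
Qed.

End RealAnalysis.

(** * Closed forms on a square are exact *)

Section ExactForms.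
Variable R : realType.
Implicit Types (f g df : R -> R) (p q U : R -> R -> R) (x y s t r h k d e D L : R).

Section ClosedForm.
Variables (p q a b c X Y : R -> R -> R) (r : R).
Hypothesis dp : forall x y, `|x| < r -> `|y| < r -> diff2 p x y (a x y) (b x y).
Hypothesis dq : forall x y, `|x| < r -> `|y| < r -> diff2 q x y (b x y) (c x y).
Hypothesis dX : forall x y, `|x| < r -> `|y| < r ->
  is_derive x 1 (X ^~ y) (p x y).
Hypothesis dY : forall x y, `|x| < r -> `|y| < r ->
  is_derive y 1 (Y x) (q x y).

(* The integral of p dx + q dy along the boundary of [x, x + h] x [y, y + k]. *)
Definition boundary x y h k : R :=
  (X (x + h) y - X x y) + (Y (x + h) (y + k) - Y (x + h) y)
  - (X (x + h) (y + k) - X x (y + k)) - (Y x (y + k) - Y x y).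

Lemma boundary_bisect x y h k :
  boundary x y (h + h) (k + k) =
  boundary x y h k + boundary (x + h) y h k + boundary x (y + k) h k
  + boundary (x + h) (y + k) h k.
Proof. by rewrite /boundary !addrA; ring. Qed.

(** Goursat's local estimate. The coefficient [b] is shared by the linear parts of p and q at (x0,
    y0), so these parts form a closed form and cancel along the boundary; only the remainders are
    left. *)
Lemma boundary_small x0 y0 (e : R) : `|x0| < r -> `|y0| < r -> 0 < e ->
  exists2 d : R, 0 < d & forall x y h k D, D < d ->
    `|x - x0| <= D -> `|x + h - x0| <= D ->
    `|y - y0| <= D -> `|y + k - y0| <= D ->
    `|boundary x y h k| <= e * D ^+ 2.
Proof.
move=> x0r y0r e0.
(* A remainder is at most e / 16 * 2D = e / 8 * D. Two of them enter each of two differences, which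
   are multiplied by |h|, |k| <= 2D: in all e * D^2. *)
have e16 : 0 < e / 16 by rewrite divr_gt0.
have [d1 d10 H1] := dp x0r y0r e16.
have [d2 d20 H2] := dq x0r y0r e16.
exists (Num.min (Num.min d1 d2) (Num.min (r - `|x0|) (r - `|y0|))).
  by rewrite !lt_min d10 d20 !subr_gt0 x0r y0r.
move=> x y h k D; rewrite !lt_min => /andP[/andP[Dd1 Dd2] /andP[Dr1 Dr2]].
move=> hx hxh hy hyk.
have xr u : `|u - x0| <= D -> `|u| < r.
  move=> u1; rewrite -[u](subrK x0) (le_lt_trans (ler_normD _ _))//.
  by rewrite -ltrBrDr (le_lt_trans u1).
have yr u : `|u - y0| <= D -> `|u| < r.
  move=> u1; rewrite -[u](subrK y0) (le_lt_trans (ler_normD _ _))//.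
  by rewrite -ltrBrDr (le_lt_trans u1).
have btw (s t u w : R) : `|s - w| <= D -> `|t - w| <= D ->
    `|u - s| <= `|t - s| -> `|u - t| <= `|t - s| -> `|u - w| <= D.
  clear; rewrite !ler_norml => /andP[? ?] /andP[? ?]; case: (ger0P (t - s));
    by move=> ? /andP[? ?] /andP[? ?]; lra.
have P u v : `|u - x0| <= D -> `|v - y0| <= D ->
   `|p u v - p x0 y0 - (a x0 y0 * (u - x0) + b x0 y0 * (v - y0))| <= e / 8 * D /\
   `|q u v - q x0 y0 - (b x0 y0 * (u - x0) + c x0 y0 * (v - y0))| <= e / 8 * D.
  move=> u1 v1.
  have := H1 (u - x0) (v - y0) (le_lt_trans u1 Dd1) (le_lt_trans v1 Dd1).
  have := H2 (u - x0) (v - y0) (le_lt_trans u1 Dd2) (le_lt_trans v1 Dd2).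
  have E : e / 16 * (`|u - x0| + `|v - y0|) <= e / 8 * D.
    have -> : e / 8 * D = e / 16 * (D + D) by field.
    by rewrite ler_wpM2l ?lerD// ltW.
  rewrite ![x0 + _]addrC ![y0 + _]addrC !subrK => h2 h1.
  by split; [exact: le_trans h1 E|exact: le_trans h2 E].
(* The mean value theorem is applied to the difference of two opposite edges, so that both are
   evaluated at the same s; this makes the linear terms -b * h * k and b * h * k cancel. *)
have [s [s1 s2 s3]] := @MVT_dist R (fun t => X t y - X t (y + k))
    (fun t => p t y - p t (y + k)) x (x + h) (fun u u1 u2 =>
    is_deriveB (dX (xr u (btw _ _ _ _ hx hxh u1 u2)) (yr _ hy))
               (dX (xr u (btw _ _ _ _ hx hxh u1 u2)) (yr _ hyk))).
have [t [t1 t2 t3]] := @MVT_dist R (fun t => Y (x + h) t - Y x t)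
    (fun t => q (x + h) t - q x t) y (y + k) (fun u u1 u2 =>
    is_deriveB (dY (xr _ hxh) (yr u (btw _ _ _ _ hy hyk u1 u2)))
               (dY (xr _ hx) (yr u (btw _ _ _ _ hy hyk u1 u2)))).
have sD := btw _ _ _ _ hx hxh s1 s2; have tD := btw _ _ _ _ hy hyk t1 t2.
have [p1 _] := P _ _ sD hy; have [p2 _] := P _ _ sD hyk.
have [_ q1] := P _ _ hxh tD; have [_ q2] := P _ _ hx tD.
set P1 := (X in `|X| <= _) in p1; set P2 := (X in `|X| <= _) in p2.
set Q1 := (X in `|X| <= _) in q1; set Q2 := (X in `|X| <= _) in q2.
have -> : boundary x y h k = h * (P1 - P2) + k * (Q1 - Q2).
  have E (u v : R) : u + v - u = v by ring.
  rewrite /= E in s3; rewrite /= E in t3.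
  rewrite /boundary /P1 /P2 /Q1 /Q2; transitivity
    (((X (x + h) y - X (x + h) (y + k)) - (X x y - X x (y + k))) +
     ((Y (x + h) (y + k) - Y x (y + k)) - (Y (x + h) y - Y x y))); first by ring.
  by rewrite [X in X + _ = _]s3 [X in _ + X = _]t3; ring.
have D0 : 0 <= D by apply: le_trans hx.
have tri (u v w : R) : `|u - w| <= D -> `|u + v - w| <= D -> `|v| <= 2 * D.
  move=> u1 u2; have -> : v = (u + v - w) - (u - w) by ring.
  by rewrite (le_trans (ler_normB _ _))// mulr_natl mulr2n lerD.
have h2 := tri _ _ _ hx hxh; have k2 := tri _ _ _ hy hyk.
have e48 : e / 4 * D = e / 8 * D + e / 8 * D by field.
have PP : `|P1 - P2| <= e / 4 * D.
  by rewrite e48 (le_trans (ler_normB _ _))// lerD.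
have QQ : `|Q1 - Q2| <= e / 4 * D.
  by rewrite e48 (le_trans (ler_normB _ _))// lerD.
rewrite (le_trans (ler_normD _ _))// !normrM.
have -> : e * D ^+ 2 = 2 * D * (e / 4 * D) + 2 * D * (e / 4 * D) by field.
by rewrite lerD// ler_pM.
Qed.

Lemma boundary_eq0 x y h k : `|x| < r -> `|y| < r -> `|x + h| < r ->
  `|y + k| < r -> boundary x y h k = 0.
Proof.
move=> xr yr xhr ykr; apply/eqP; rewrite -normr_le0 leNgt; apply/negP => I0.
(* The rectangle is parametrised by the unit square, h and k having either sign. A subrectangle of
   generation n keeps at least a 4^-n share of the boundary integral. *)
pose P s t n := `|boundary x y h k| / 4 ^+ n <=
  `|boundary (x + h * s) (y + k * t) (h * (1 / 2 ^+ n)) (k * (1 / 2 ^+ n))|.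
have [||s0 [t0 [s01 t01 Hn]]] := @dyadic_bisection R P.
- by rewrite /P !expr0 !divr1 !mulr0 !mulr1 !addr0.
- move=> s t n; rewrite {1}/P.
  have -> : 1 / 2 ^+ n = 1 / 2 ^+ n.+1 + 1 / 2 ^+ n.+1 :> R.
    by rewrite exprS; field; rewrite expf_neq0.
  rewrite ![_ * (_ + _)]mulrDr boundary_bisect -![x + _ + _]addrA -!mulrDr.
  rewrite -![y + _ + _]addrA -!mulrDr.
  have -> : `|boundary x y h k| / 4 ^+ n = 4 * (`|boundary x y h k| / 4 ^+ n.+1).
    by rewrite exprS; field; rewrite expf_neq0.
  move=> H; apply: contrapT => nH.
  have N (u v : bool) : ~ P (s + u%:R / 2 ^+ n.+1) (t + v%:R / 2 ^+ n.+1) n.+1.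
    by move=> H'; apply: nH; exists u, v.
  have := N true true; have := N true false.
  have := N false true; have := N false false.
  rewrite /P !mul0r !addr0 => /negP + /negP + /negP + /negP.
  rewrite -!ltNge => h1 h2 h3 h4.
  move: H; apply/negP; rewrite -ltNge.
  have T (A B C D : R) : `|A + B + C + D| <= `|A| + `|B| + `|C| + `|D|.
    rewrite (le_trans (ler_normD _ _))// lerD2r.
    by rewrite (le_trans (ler_normD _ _))// lerD2r ler_normD.
  rewrite (le_lt_trans (T _ _ _ _))//.
  by rewrite !mulrDr in h1 h2 h3 h4 *; lra.
pose L : R := `|h| + `|k|.
have L0 : 0 <= L by rewrite addr_ge0.
have cvx (u v w : R) : `|u| < r -> `|u + v| < r -> 0 <= w <= 1 ->
    `|u + v * w| < r.
  move=> ur uvr /andP[w0 w1].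
  have -> : u + v * w = (1 - w) * u + w * (u + v) by ring.
  rewrite (le_lt_trans (ler_normD _ _))// !normrM (ger0_norm w0) ger0_norm
    ?subr_ge0//.
  have mr : Num.max `|u| `|u + v| < r by rewrite gt_max ur.
  rewrite (le_lt_trans _ mr)//.
  have -> : Num.max `|u| `|u + v| =
    (1 - w) * Num.max `|u| `|u + v| + w * Num.max `|u| `|u + v| by ring.
  by rewrite lerD// ler_wpM2l ?subr_ge0// le_max lexx ?orbT.
(* At scale L / 2^n the local estimate gives e * L^2 / 4^n, strictly less than the share kept by the
   bisection. *)
pose e : R := `|boundary x y h k| / (L ^+ 2 + 1).
have L1 : 0 < L ^+ 2 + 1 by rewrite ltr_wpDl// sqr_ge0.
have e0 : 0 < e by rewrite divr_gt0.
have [d d0 Hd] := boundary_small (cvx _ _ _ xr xhr s01) (cvx _ _ _ yr ykr t01) e0.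
have [n Ln] : exists n, L / 2 ^+ n < d.
  have dL : 0 < d / (L + 1) by rewrite divr_gt0// ltr_wpDl.
  have [N _ /(_ N (leqnn N))] := near_infty_natSinv_expn_lt (PosNum dL).
  rewrite /= ltr_pdivlMr ?ltr_wpDl// => H; exists N.
  have q0 : 0 < 1 / 2 ^+ N :> R by rewrite divr_gt0// exprn_gt0.
  by rewrite (lt_trans _ H)// div1r mulrC ltr_pM2l ?ltrDl//; rewrite div1r in q0.
have [s [t [[Pst s1 s2 s3 s4] [t1 t2 t3 t4]]]] := Hn n.
have q0 : 0 < 1 / 2 ^+ n :> R by rewrite divr_gt0// exprn_gt0.
have close u v s' t' : `|v| <= L -> 0 <= s' -> s' <= t' -> t' <= s' + 1 / 2 ^+ n ->
    `|u + v * s' - (u + v * t')| <= L / 2 ^+ n /\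
    `|u + v * s' + v * (1 / 2 ^+ n) - (u + v * t')| <= L / 2 ^+ n.
  move=> vL s'0 st ts.
  have -> : u + v * s' - (u + v * t') = v * (s' - t') by ring.
  have -> : u + v * s' + v * (1 / 2 ^+ n) - (u + v * t') =
     v * (s' + 1 / 2 ^+ n - t') by ring.
  have -> : L / 2 ^+ n = L * (1 / 2 ^+ n) by rewrite div1r.
  rewrite !normrM; split; apply: ler_pM => //; rewrite ler_norml.
    by apply/andP; split; lra.
  by apply/andP; split; lra.
have hL : `|h| <= L by rewrite lerDl.
have kL : `|k| <= L by rewrite lerDr.
have [c1 c2] := close x h s s0 hL s1 s2 s3.
have [c3 c4] := close y k t t0 kL t1 t2 t3.
have := le_trans Pst (Hd _ _ _ _ _ Ln c1 c2 c3 c4).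
have -> : e * (L / 2 ^+ n) ^+ 2 = e * L ^+ 2 / 4 ^+ n.
  have -> : 4 = 2 ^+ 2 :> R by ring.
  by rewrite exprAC; field; rewrite expf_neq0.
rewrite ler_pM2r ?invr_gt0 ?exprn_gt0//.
rewrite /e -mulrAC ler_pdivlMr// ler_pM2l//; lra.
Qed.

End ClosedForm.

Lemma diff2_continuous p x y a b : diff2 p x y a b ->
  forall e, 0 < e -> exists2 d, 0 < d & forall h k, `|h| < d -> `|k| < d ->
    `|p (x + h) (y + k) - p x y| <= e.
Proof.
move=> H e e0; have [d d0 Hd] := H 1 ltr01.
(* The terms |a| and |b| absorb the linear part, the 2 absorbs the remainder |h| + |k|. *)
pose M : R := `|a| + `|b| + 2.
have M0 : 0 < M by rewrite ltr_wpDl.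
exists (Num.min d (e / M)); first by rewrite lt_min d0 divr_gt0.
move=> h k; rewrite !lt_min => /andP[hd he] /andP[kd ke].
have := Hd h k hd kd; rewrite mul1r => D.
set z := p _ _ - _ in D *.
rewrite -[z](subrK (a * h + b * k)) (le_trans (ler_normD _ _))//.
have -> : e = (`|a| * (e / M) + `|b| * (e / M)) + (e / M + e / M).
  rewrite /M; field; rewrite gt_eqF// -/M//.
rewrite addrC lerD//; last by rewrite (le_trans D)// lerD// ltW.
by rewrite (le_trans (ler_normD _ _))// !normrM lerD// ler_wpM2l// ltW.
Qed.

Theorem closed_form_exact p q (a b c : R -> R -> R) r r' : 0 < r' -> r' < r ->
  (forall x y, `|x| < r -> `|y| < r -> diff2 p x y (a x y) (b x y)) ->
  (forall x y, `|x| < r -> `|y| < r -> diff2 q x y (b x y) (c x y)) ->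
  exists U, forall x y, `|x| < r' -> `|y| < r' -> diff2 U x y (p x y) (q x y).
Proof.
move=> r'0 rr dp dq.
have der_cont g y u : is_derive y 1 g u -> {for y, continuous g}.
  by move=> [d _]; exact/differentiable_continuous/derivable1_diffP.
(* [X] and [Y] are chosen line by line, without any regularity in the other variable; the vanishing
   of [boundary] relates the different lines. *)
have /choice[X HX] y : exists G, `|y| < r' -> forall x, `|x| < r' ->
    is_derive x 1 G (p x y).
  have [y'|] := pselect (`|y| < r'); last by exists (fun=> 0).
  have [|G HG] := @antiderivative R (p ^~ y) _ _ rr; last by exists G.
  by move=> x xr; exact: der_cont (diff2_x (dp _ _ xr (lt_trans y' rr))).
have /choice[Y HY] x : exists G, `|x| < r' -> forall y, `|y| < r' ->
    is_derive y 1 G (q x y).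
  have [x'|] := pselect (`|x| < r'); last by exists (fun=> 0).
  have [|G HG] := @antiderivative R (q x) _ _ rr; last by exists G.
  by move=> y yr; exact: der_cont (diff2_y (dq _ _ (lt_trans x' rr) yr)).
have B x y h k := @boundary_eq0 p q a b c (fun x y => X y x) Y r'
  (fun x y xr yr => dp x y (lt_trans xr rr) (lt_trans yr rr))
  (fun x y xr yr => dq x y (lt_trans xr rr) (lt_trans yr rr))
  (fun x y xr yr => HX y yr x xr) (fun x y xr yr => HY x xr y yr) x y h k.
have z0 : `|0 : R| < r' by rewrite normr0.
(* U integrates along the horizontal axis and then vertically. The two instances of [B] below turn
   its increment into one horizontal piece from (x, y) to (x + h, y) and one vertical piece from
   there, so continuity of p and q suffices. *)
exists (fun x y => X 0 x - X 0 0 + (Y x y - Y x 0)) => x y xr yr e e0.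
have e20 : 0 < e / 2 by rewrite divr_gt0.
have [d1 d10 H1] := diff2_continuous (dp _ _ (lt_trans xr rr) (lt_trans yr rr)) e0.
have [d2 d20 H2] := diff2_continuous (dq _ _ (lt_trans xr rr) (lt_trans yr rr)) e0.
exists (Num.min (Num.min d1 d2) (Num.min (r' - `|x|) (r' - `|y|))).
  by rewrite !lt_min d10 d20 !subr_gt0 xr yr.
move=> h k; rewrite !lt_min => /andP[/andP[hd1 hd2] /andP[hx _]].
move=> /andP[/andP[kd1 kd2] /andP[_ ky]].
have xs s : `|s - x| <= `|h| -> `|s| < r'.
  move=> sx; rewrite -[s](subrK x) (le_lt_trans (ler_normD _ _))//.
  by rewrite -ltrBrDr (le_lt_trans sx).
have ys t : `|t - y| <= `|k| -> `|t| < r'.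
  move=> ty; rewrite -[t](subrK y) (le_lt_trans (ler_normD _ _))//.
  by rewrite -ltrBrDr (le_lt_trans ty).
have E (u v : R) : u + v - u = v by ring.
have xh : `|x + h| < r' by apply: xs; rewrite E.
have yk : `|y + k| < r' by apply: ys; rewrite E.
have [|s [s1 s2 s3]] := @MVT_dist R (X y) (p ^~ y) x (x + h).
  by rewrite E => u u1 _; apply: HX => //; exact: xs.
have [|t [t1 t2 t3]] := @MVT_dist R (Y (x + h)) (q (x + h)) y (y + k).
  by rewrite E => u u1 _; apply: HY => //; exact: ys.
rewrite E in s1 s3; rewrite E in t1 t3.
have := B 0 0 (x + h) y z0 z0; have := B 0 0 x y z0 z0.
rewrite /boundary !add0r => /(_ xr yr) B1 /(_ xh yr) B2.
have := H1 (s - x) 0; rewrite addr0 normr0 [x + (_ - _)]addrC subrK.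
move=> /(_ (le_lt_trans s1 hd1) d10) h1.
have := H2 h (t - y) hd2 (le_lt_trans t1 kd2); rewrite [y + (_ - _)]addrC subrK => h2.
set Z := (X in `|X|); have -> : Z = (p s y - p x y) * h + (q (x + h) t - q x y) * k.
  by rewrite /Z; move: s3 t3 B1 B2; clear; lra.
by rewrite mulrDr (le_trans (ler_normD _ _))// !normrM lerD// ler_wpM2r.
Qed.

End ExactForms.

(** * Complex derivatives and primitives *)

Section ComplexDerivative.
Variable R : realType.
Local Notation C := (cplx R).
Implicit Types (F f : C -> C) (z d : C) (x y r e : R).

Definition cart (p : R * R) : C := (p.1 +i* p.2)%C.
Definition re_of f x y : R := complex.Re (f (cart (x, y))).
Definition im_of f x y : R := complex.Im (f (cart (x, y))).

Lemma normE z : `|z| = (normc z)%:C%C.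
Proof. by []. Qed.

Lemma normc_le x y : normc (cart (x, y)) <= `|x| + `|y|.
Proof.
rewrite /= -[leRHS]ger0_norm ?addr_ge0// -sqrtr_sqr ler_wsqrtr//.
rewrite sqrrD !real_normK ?num_real// -addrA lerD2l lerDr.
by rewrite mulrn_wge0 ?mulr_ge0.
Qed.

Lemma Re_le_normc z : `|complex.Re z| <= normc z.
Proof.
by case: z => x y /=; rewrite -sqrtr_sqr ler_wsqrtr// lerDl sqr_ge0.
Qed.

Lemma Im_le_normc z : `|complex.Im z| <= normc z.
Proof.
by case: z => x y /=; rewrite -sqrtr_sqr ler_wsqrtr// lerDr sqr_ge0.
Qed.

Lemma normc_ge0 z : 0 <= normc z.
Proof. by case: z => x y; exact: sqrtr_ge0. Qed.

Lemma cart_eta z : cart (complex.Re z, complex.Im z) = z.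
Proof. by case: z. Qed.

Lemma cartD x y x' y' : cart (x, y) + cart (x', y') = cart (x + x', y + y').
Proof. by []. Qed.

(** Radii and errors are real here, while in the normed field C they are positive elements of C.
    Positive complex numbers being real, [cderiveP] can pass between the two. *)
Definition cderive f z d : Prop :=
  forall e, 0 < e -> exists2 r, 0 < r & forall h : C, normc h < r ->
    normc (f (z + h) - f z - d * h) <= e * normc h.

Lemma cderiveP f z d : is_derive z 1 f d <-> cderive f z d.
Proof.
rewrite is_derive_epsP; split=> H e e0.
  have [|r r0 Hr] := H e%:C%C; first by rewrite ltcR.
  have rE : r = (complex.Re r)%:C%C by rewrite RRe_real// gtr0_real.
  exists (complex.Re r); first by rewrite -ltcR -rE.
  move=> h hr; have := Hr h; rewrite !normE rE ltcR => /(_ hr).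
  by rewrite -rmorphM lecR.
have eE : e = (complex.Re e)%:C%C by rewrite RRe_real// gtr0_real.
have [|r r0 Hr] := H (complex.Re e); first by rewrite -ltcR -eE.
exists r%:C%C; first by rewrite ltcR.
by move=> h; rewrite !normE ltcR => /Hr; rewrite -lecR rmorphM/= -eE.
Qed.

(** The Cauchy-Riemann equations as an equivalence; the converse assembles a complex primitive from
    two real potentials. *)
Lemma cderive_diff2 f x y d : cderive f (cart (x, y)) d <->
  diff2 (re_of f) x y (complex.Re d) (- complex.Im d) /\
  diff2 (im_of f) x y (complex.Im d) (complex.Re d).
Proof.
have E h k : re_of f (x + h) (y + k) - re_of f x y -
      (complex.Re d * h + - complex.Im d * k) =
    complex.Re (f (cart (x, y) + cart (h, k)) - f (cart (x, y)) - d * cart (h, k))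
  /\ im_of f (x + h) (y + k) - im_of f x y -
      (complex.Im d * h + complex.Re d * k) =
    complex.Im (f (cart (x, y) + cart (h, k)) - f (cart (x, y)) - d * cart (h, k)).
  rewrite /re_of /im_of cartD; case: (f _) => u v; case: (f _) => u' v'.
  by case: d => d1 d2 /=; split; ring.
split=> [H|[H1 H2] e e0].
  split=> e e0; have [r r0 Hr] := H e e0; exists (r / 2); rewrite ?divr_gt0//.
    move=> h k hr kr; have [-> _] := E h k; apply: (le_trans (Re_le_normc _)).
    have hk : normc (cart (h, k)) < r.
      by rewrite (le_lt_trans (normc_le _ _))// [r]splitr ltrD.
    by rewrite (le_trans (Hr _ hk))// ler_wpM2l ?normc_le// ltW.
  move=> h k hr kr; have [_ ->] := E h k; apply: (le_trans (Im_le_normc _)).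
  have hk : normc (cart (h, k)) < r.
    by rewrite (le_lt_trans (normc_le _ _))// [r]splitr ltrD.
  by rewrite (le_trans (Hr _ hk))// ler_wpM2l ?normc_le// ltW.
have e4 : 0 < e / 4 by rewrite divr_gt0.
have [r1 r10 Hr1] := H1 _ e4; have [r2 r20 Hr2] := H2 _ e4.
exists (Num.min r1 r2); rewrite ?lt_min ?r10// => h; rewrite lt_min => /andP[h1 h2].
have hx := Re_le_normc h; have hy := Im_le_normc h.
have := Hr1 _ _ (le_lt_trans hx h1) (le_lt_trans hy h1).
have := Hr2 _ _ (le_lt_trans hx h2) (le_lt_trans hy h2).
have [-> ->] := E (complex.Re h) (complex.Im h); rewrite cart_eta.
set w := f _ - _ - _ => w2 w1.
have hh : e / 4 * (`|complex.Re h| + `|complex.Im h|) <= e / 2 * normc h.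
  have -> : e / 2 * normc h =
    e / 4 * (normc h + normc h) by field.
  by rewrite ler_wpM2l ?lerD// ltW.
rewrite -(cart_eta w) (le_trans (normc_le _ _))//.
have -> : e * normc h =
  e / 2 * normc h + e / 2 * normc h by field.
by rewrite lerD// ?(le_trans w1)// ?(le_trans w2).
Qed.

Definition sq r : set C := [set z | `|complex.Re z| < r /\ `|complex.Im z| < r].

(** With f = u + iv, the real and imaginary parts of f dz are u dx - v dy and v dx + u dy, and the
    Cauchy-Riemann equations make both closed. *)
Theorem has_primitive f r r' : 0 < r' -> r' < r ->
  (forall z, sq r z -> derivable f z 1) ->
  exists F, forall z, sq r' z -> is_derive z 1 F (f z).
Proof.
move=> r'0 rr df.
pose D x y := 'D_1 f (cart (x, y)).
have H x y : `|x| < r -> `|y| < r -> cderive f (cart (x, y)) (D x y).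
  by move=> xr yr; apply/cderiveP/derivableP/df; split.
have N (p : R -> R -> R) x y a b : diff2 p x y a b ->
    diff2 (fun x y => - p x y) x y (- a) (- b).
  move=> dp e e0; have [d d0 Hd] := dp e e0; exists d => // h k hd kd.
  by rewrite -normrN; have := Hd h k hd kd; congr (`|_| <= _); ring.
have [||U1 HU1] := @closed_form_exact R (re_of f) (fun x y => - im_of f x y)
  (fun x y => complex.Re (D x y)) (fun x y => - complex.Im (D x y))
  (fun x y => - complex.Re (D x y)) r r' r'0 rr.
- by move=> x y xr yr; have /cderive_diff2[] := H x y xr yr.
- by move=> x y xr yr; apply: N; have /cderive_diff2[] := H x y xr yr.
have [||U2 HU2] := @closed_form_exact R (im_of f) (re_of f)
  (fun x y => complex.Im (D x y)) (fun x y => complex.Re (D x y))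
  (fun x y => - complex.Im (D x y)) r r' r'0 rr.
- by move=> x y xr yr; have /cderive_diff2[] := H x y xr yr.
- by move=> x y xr yr; have /cderive_diff2[] := H x y xr yr.
exists (fun z => cart (U1 (complex.Re z) (complex.Im z),
                       U2 (complex.Re z) (complex.Im z))).
move=> z [zr1 zr2]; apply/cderiveP; rewrite -(cart_eta z); apply/cderive_diff2.
by split; [exact: HU1|exact: HU2].
Qed.

End ComplexDerivative.

(** * The maximum principle *)

Section RealLemmas.
Variable R : realType.
Implicit Types (x y r t : R).

Lemma MVT_oo (f df : R -> R) a b : a < b ->
  (forall t, a <= t <= b -> is_derive t 1 f (df t)) ->
  exists c, [/\ a < c, c < b & f b - f a = df c * (b - a)].
Proof.
move=> ab Hf; have [||c] := @MVT R f df a b ab.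
- by move=> t; rewrite in_itv/= => /andP[? ?]; apply: Hf; rewrite !ltW.
- by apply: derivable_within_continuous => t; rewrite in_itv/= => /Hf[].
by rewrite in_itv/= => /andP[? ?] ?; exists c.
Qed.

(** If a > 0, the derivative is above df t0 just to the right of t0 and below it just to the left.
    The sign of df t0 then decides on which side f takes a larger value, so df t0 = 0 need not be
    shown first. *)
Lemma local_max_second_derivative (f df : R -> R) t0 a r : 0 < r ->
  (forall t, `|t - t0| < r -> is_derive t 1 f (df t)) -> is_derive t0 1 df a ->
  (forall t, `|t - t0| < r -> f t <= f t0) -> a <= 0.
Proof.
move=> r0 Hf /is_derive_epsP Hd fmax; rewrite leNgt; apply/negP => a0.
have a20 : 0 < a / 2 by rewrite divr_gt0.
have [d d0 {}Hd] := Hd (a / 2) a20.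
pose m := Num.min d r / 2.
have m0 : 0 < m by rewrite divr_gt0// lt_min d0.
have mdr : m < Num.min d r by rewrite /m ltr_pdivrMr// ltr_pMr ?ltrDl// lt_min d0.
move: mdr; rewrite lt_min => /andP[md mr].
have mono c : `|c - t0| <= m ->
    `|df c - df t0 - a * (c - t0)| <= a / 2 * `|c - t0|.
  by move=> cm; have := Hd _ (le_lt_trans cm md); rewrite [t0 + _]addrC subrK.
have [pos|neg] := leP 0 (df t0).
  have [||c [c1 c2 c3]] := @MVT_oo f df t0 (t0 + m); first by rewrite ltrDl.
    move=> t /andP[t1 t2]; apply: Hf; apply: le_lt_trans mr.
    by rewrite ler_norml; lra.
  have fm : f (t0 + m) <= f t0.
    by apply: fmax; rewrite addrC addKr gtr0_norm.
  have /ler_normlP[h1 h2] : `|df c - df t0 - a * (c - t0)| <= a / 2 * (c - t0).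
    by rewrite -[X in _ <= _ * X]gtr0_norm ?subr_gt0// mono// gtr0_norm; lra.
  have q : 0 < a / 2 * (c - t0) by rewrite mulr_gt0// subr_gt0.
  have : 0 < df c by lra.
  by rewrite -(pmulr_lgt0 _ m0) -[X in _ * X](addKr t0) [- t0 + _]addrC -c3; lra.
have [||c [c1 c2 c3]] := @MVT_oo f df (t0 - m) t0; first by rewrite gtrBl.
  move=> t /andP[t1 t2]; apply: Hf; apply: le_lt_trans mr.
  by rewrite ler_norml; lra.
have fm : f (t0 - m) <= f t0.
  by apply: fmax; rewrite addrC addKr normrN gtr0_norm.
have /ler_normlP[h1 h2] : `|df c - df t0 - a * (c - t0)| <= a / 2 * - (c - t0).
  by rewrite -[X in _ <= _ * X]ltr0_norm ?subr_lt0// mono// ltr0_norm; lra.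
have q : 0 < a / 2 * (t0 - c) by rewrite mulr_gt0// subr_gt0.
have : df c < 0 by lra.
have tm : t0 - (t0 - m) = m by ring.
by rewrite -(pmulr_llt0 _ m0) -[X in _ * X]tm -c3; lra.
Qed.

End RealLemmas.

Section MaximumPrinciple.
Variable R : realType.
Local Notation C := (cplx R).
Implicit Types (F f G : C -> C) (z c : C) (x y r m e : R) (p : R * R).
Implicit Types (D : set C) (K : set (R * R)).

Lemma cvg_sqr (T : Type) (H : set_system T) {FH : Filter H} (u : T -> R) (a : R) :
  u @ H --> a -> (fun t => u t ^+ 2) @ H --> a ^+ 2.
Proof. by move=> ua; under eq_fun do rewrite expr2; exact: cvgM. Qed.

Lemma diff2_cvg (P : R -> R -> R) x y a b : diff2 P x y a b ->
  {for (x, y), continuous (fun p => P p.1 p.2)}.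
Proof.
move=> H; apply/cvgrPdist_le => e e0 /=.
have [d d0 Hd] := diff2_continuous H e0.
exists (ball x d, ball y d); first by split; exact: nbhsx_ballx.
move=> [x' y'] [/= xd yd]; rewrite distrC.
have := Hd (x' - x) (y' - y); rewrite ![_ + (_ - _)]addrC !subrK; apply.
  by rewrite distrC.
by rewrite distrC.
Qed.

(** The regularity of a primitive of a merely differentiable function. It is stable under the
    products and powers that the barrier argument forms. *)
Definition twice_derivable D F : Prop :=
  exists2 f, forall z, D z -> is_derive z 1 F (f z) &
             forall z, D z -> derivable f z 1.

Lemma twice_derivableM D F G :
  twice_derivable D F -> twice_derivable D G -> twice_derivable D (F * G).
Proof.
move=> [f Ff df] [g Gg dg]; exists (F * g + G * f) => z Dz.
  have := Ff z Dz; have := Gg z Dz => h1 h2; exact: is_deriveM.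
have [dF _] := Ff z Dz; have [dG _] := Gg z Dz.
exact: (derivableD (derivableM dF (dg z Dz)) (derivableM dG (df z Dz))).
Qed.

Lemma twice_derivable_cst D (a : C) : twice_derivable D (cst a).
Proof. by exists (cst 0) => z _; [exact: is_derive_cst|exact: derivable_cst]. Qed.

Lemma twice_derivableX D F k :
  twice_derivable D F -> twice_derivable D (F ^+ k).
Proof.
move=> dF; elim: k => [|k IH]; first by rewrite expr0; exact: twice_derivable_cst.
by rewrite exprS; exact: twice_derivableM.
Qed.

Lemma is_derive_inv (g : C -> C) z d : is_derive z 1 g d -> g z != 0 ->
  is_derive z 1 (fun w => (g w)^-1) (- (g z) ^- 2 * d).
Proof.
move=> [dg <-] gz; apply: DeriveDef; first exact: derivableV.
by rewrite deriveV.
Qed.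

Lemma twice_derivable_inv D c :
  ~ D c -> twice_derivable D (fun z => (z - c)^-1).
Proof.
move=> Dc; have neq z : D z -> z - c != 0.
  by move=> Dz; apply/eqP => /subr0_eq zc; apply: Dc; rewrite -zc.
have dB z : is_derive z 1 (fun z => z - c) (1 : C).
  have := is_deriveB (is_derive_id z (1 : C)) (is_derive_cst c z (1 : C)).
  by rewrite subr0.
have dV z : D z -> is_derive z 1 (fun z => (z - c)^-1) (- ((z - c) ^- 2)).
  by move=> /neq; have := is_derive_inv (dB z); rewrite mulr1; exact.
exists (fun z => - ((z - c) ^- 2)) => // z Dz.
have [dz _] := dV z Dz.
have -> : (fun z => - (z - c) ^- 2) = - ((fun z : C => (z - c)^-1) ^+ 2).
  by apply/funext => w; rewrite !fctE exprVn.
by apply: derivableN; exact: derivableX.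
Qed.

Lemma cart_interior K p : K° p -> exists2 d, 0 < d & forall h k,
  `|h| < d -> `|k| < d -> K (p.1 + h, p.2 + k).
Proof.
case: p => x y [[A B] /= [[d1 /= d10 H1] [d2 /= d20 H2]] H].
exists (Num.min d1 d2); rewrite ?lt_min ?d10// => h k.
rewrite !lt_min => /andP[h1 h2] /andP[k1 k2]; apply: (H (_, _)) => /=; split.
  by apply: H1; rewrite /ball/= opprD addNKr normrN.
by apply: H2; rewrite /ball/= opprD addNKr normrN.
Qed.

(** Re F is harmonic: its second derivatives in x and y at the point are Re w and -Re w. The
    quadratic term adds 2e to each, and the two sums cannot both be nonpositive. *)
Lemma no_interior_max D K F e p : 0 < e -> twice_derivable D F ->
  (forall q, K q -> D (cart q)) -> K° p ->
  (forall q, K q -> re_of F q.1 q.2 + e * (q.1 ^+ 2 + q.2 ^+ 2) <=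
                    re_of F p.1 p.2 + e * (p.1 ^+ 2 + p.2 ^+ 2)) -> False.
Proof.
move=> e0 [f Ff df] KD Kp pmax; have [d d0 Kd] := cart_interior Kp.
case: p => x y /= in Kp pmax Kd *.
have Dz h k : `|h - x| < d -> `|k - y| < d -> D (cart (h, k)).
  move=> hd kd; have := Kd _ _ hd kd.
  by rewrite ![_ + (_ - _)]addrC !subrK => /KD.
have nz (u : R) : `|u - u| < d by rewrite subrr normr0.
have dF h k : `|h - x| < d -> `|k - y| < d ->
    diff2 (re_of F) h k (re_of f h k) (- im_of f h k).
  by move=> hd kd; have /cderiveP/cderive_diff2[] := Ff _ (Dz h k hd kd).
have /derivableP/cderiveP/cderive_diff2[d1 d2] := df _ (Dz x y (nz x) (nz y)).
set w := 'D_1 f _ in d1 d2.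
have sq2 (t : R) : is_derive t 1 (fun t => e * t ^+ 2) (2 * e * t).
  have -> : 2 * e * t = e * (t *: 1 + t *: 1).
    by rewrite /GRing.scale/=; ring.
  exact: (is_deriveZ e (is_deriveM (is_derive_id t 1) (is_derive_id t 1))).
have lin (t : R) : is_derive t 1 (fun t => 2 * e * t) (2 * e).
  by have := is_deriveZ (2 * e) (is_derive_id t (1 : R));
    rewrite /GRing.scale/= mulr1.
have A1 : complex.Re w + 2 * e <= 0.
  apply: (@local_max_second_derivative R
    (fun t => re_of F t y + e * t ^+ 2) (fun t => re_of f t y + 2 * e * t) x _ d d0).
  - by move=> t td; apply: is_deriveD; exact: diff2_x (dF _ _ td (nz y)).
  - by apply: is_deriveD; exact: diff2_x d1.
  - move=> t td; have := pmax (t, y).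
    have := Kd (t - x) 0; rewrite [x + _]addrC subrK addr0 normr0 => /(_ td d0) Kty.
    by move=> /(_ Kty) /=; rewrite !mulrDr !addrA lerD2r.
have A2 : - complex.Re w + 2 * e <= 0.
  apply: (@local_max_second_derivative R
    (fun t => re_of F x t + e * t ^+ 2) (fun t => - im_of f x t + 2 * e * t) y _
      d d0).
  - by move=> t td; apply: is_deriveD; exact: diff2_y (dF _ _ (nz x) td).
  - by apply: is_deriveD; apply: is_deriveN; exact: diff2_y d2.
  - move=> t td; have := pmax (x, t).
    have := Kd 0 (t - y); rewrite [y + _]addrC subrK addr0 normr0 => /(_ d0 td) Kty.
    move=> /(_ Kty) /=; rewrite [x ^+ 2 + t ^+ 2]addrC [x ^+ 2 + y ^+ 2]addrC.
    by rewrite !mulrDr !addrA lerD2r.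
lra.
Qed.

Lemma continuous_on_re_im D K F : twice_derivable D F ->
  (forall q, K q -> D (cart q)) ->
  {in K, continuous (fun q => re_of F q.1 q.2)} /\
  {in K, continuous (fun q => im_of F q.1 q.2)}.
Proof.
move=> [f Ff _] KD; split=> -[x y]; rewrite inE => /KD/Ff/cderiveP/cderive_diff2[].
  by move=> h _; exact: diff2_cvg h.
by move=> _ h; exact: diff2_cvg h.
Qed.

(** The boundary is read as the points of K outside its interior. Multiplication by the unit [th]
    makes the value at p real and positive, which reduces the bound on the modulus to one on a real
    part. *)
Lemma max_principle D K F m : 0 <= m -> compact K -> twice_derivable D F ->
  (forall q, K q -> D (cart q)) ->
  (forall q, K q -> ~ K° q -> normc (F (cart q)) <= m) ->
  forall q, K q -> normc (F (cart q)) <= m.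
Proof.
move=> m0 cK dF KD Fm p Kp; rewrite leNgt; apply/negP => mp.
set w := F (cart p) in mp.
have w0 : normc w != 0 by rewrite gt_eqF// (le_lt_trans m0).
pose th : C := (w^* / `|w|).
have thwE : th * w = `|w|.
  have w0' : `|w| != 0.
    by apply/eqP => /(congr1 (@complex.Re R)) wz; move/eqP: w0; exact.
  by rewrite /th mulrAC [_ * w]mulrC -sqr_normc expr2 mulfK.
have thw : complex.Re (th * w) = normc w by rewrite thwE.
have th1 : normc th = 1.
  apply: (mulIf w0); rewrite -normcM thwE mul1r.
  by apply: complexI; rewrite -!normE normr_id.
have dG := twice_derivableM (twice_derivable_cst D th) dF.
set G := _ * F in dG.
have cN : {within K, continuous (fun q : R * R => q.1 ^+ 2 + q.2 ^+ 2)}.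
  apply: continuous_subspaceT => q.
  by apply: cvgD; apply: cvg_sqr; [exact: cvg_fst|exact: cvg_snd].
have K0 : K !=set0 by exists p.
have [b _ bmax] := compact_EVT_max K0 cK cN.
set B := (b.1 ^+ 2 + _) in bmax.
have B0 : 0 <= B by rewrite addr_ge0 ?sqr_ge0.
(* The perturbation is at most e * B on K, too little to bridge the gap between m and normc w; the
   perturbed maximum is therefore attained in the interior. *)
pose e := (normc w - m) / (B + 1).
have B1 : 0 < B + 1 by rewrite ltr_wpDl.
have e0 : 0 < e by rewrite divr_gt0 ?subr_gt0.
have eB : m + e * B < normc w.
  by rewrite -ltrBrDl /e -mulrAC ltr_pdivrMr// ltr_pM2l ?subr_gt0// ltrDl.
have [cG _] := continuous_on_re_im dG KD.
have cu : {within K, continuous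
    (fun q : R * R => re_of G q.1 q.2 + e * (q.1 ^+ 2 + q.2 ^+ 2))}.
  apply: continuous_in_subspaceT => q Kq; apply: cvgD; first exact: cG.
  apply: cvgM; first exact: cvg_cst.
  by apply: cvgD; apply: cvg_sqr; [exact: cvg_fst|exact: cvg_snd].
have [p1 Kp1 p1max] := compact_EVT_max K0 cK cu.
rewrite inE in Kp1.
have Ip1 : K° p1.
  apply: contrapT => /(Fm _ Kp1) F1.
  have := p1max p (mem_set Kp); rewrite /re_of -!surjective_pairing.
  apply/negP; rewrite -ltNge.
  rewrite (@le_lt_trans _ _ (m + e * B))//.
    rewrite lerD// ?ler_wpM2l// ?(ltW e0)//; last by apply: bmax; rewrite inE.
    rewrite (le_trans _ F1)//.
    rewrite (le_trans (ler_norm _))// (le_trans (Re_le_normc _))//.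
    by rewrite normcM th1 mul1r.
  rewrite (lt_le_trans eB)// -[leLHS]addr0 lerD//.
    by rewrite thw.
  by rewrite mulr_ge0 ?(ltW e0)// addr_ge0 ?sqr_ge0.
apply: (no_interior_max e0 dG KD Ip1) => q Kq; apply: p1max; exact: mem_set.
Qed.

End MaximumPrinciple.

(** * Comparison with powers of 1 / (z - c) *)

Section Barrier.
Variable R : realType.
Local Notation C := (cplx R).
Implicit Types (F f G : C -> C) (z c : C) (x y r m e t s : R) (p q : R * R).
Implicit Types (D : set C).

Lemma geometric_bounded x m rho : 0 <= x -> 1 < rho ->
  (forall k, x * rho ^+ k <= m) -> x = 0.
Proof.
move=> x0 rho1 H; apply/eqP; rewrite eq_le x0 andbT leNgt; apply/negP => xpos.
have bern k : 1 + k%:R * (rho - 1) <= rho ^+ k.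
  elim: k => [|k IH]; first by rewrite mul0r addr0 expr0.
  rewrite exprS -(ler_pM2l (lt_trans ltr01 rho1)) in IH *.
  rewrite (le_trans _ IH)// -natr1; have : 0 <= k%:R * (rho - 1) ^+ 2.
    by rewrite mulr_ge0// sqr_ge0.
  by lra.
have d0 : 0 < rho - 1 by rewrite subr_gt0.
have xd : 0 < x * (rho - 1) by rewrite mulr_gt0.
have := @archi_boundP R (`|m| / (x * (rho - 1))).
rewrite divr_ge0 ?(ltW xd)// ltr_pdivrMr// => /(_ isT).
set k := Num.bound _ => kb; have := H k; apply/negP; rewrite -ltNge.
rewrite (lt_le_trans _ (ler_wpM2l x0 (bern k)))//.
by rewrite (le_lt_trans (ler_norm _))// (lt_trans kb)//; lra.
Qed.

(* For [F] vanishing on [A = 0], the maximum principle applied to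
   [F * (r / (z - c)) ^ k] on the part of the disc around [c] where [A >= 0]
   bounds [F] by [M * (|z - c| / r) ^ k], for every [k]. *)
Lemma barrier D F (A : R * R -> R) (c1 c2 r : R) : 0 < r -> continuous A ->
  A (c1, c2) < 0 -> twice_derivable D F ->
  (forall q, 0 <= A q -> (q.1 - c1) ^+ 2 + (q.2 - c2) ^+ 2 <= r ^+ 2 ->
     D (cart q)) ->
  (forall q, A q = 0 -> (q.1 - c1) ^+ 2 + (q.2 - c2) ^+ 2 <= r ^+ 2 ->
     F (cart q) = 0) ->
  forall q, 0 <= A q -> (q.1 - c1) ^+ 2 + (q.2 - c2) ^+ 2 < r ^+ 2 ->
    F (cart q) = 0.
Proof.
move=> r0 cA Ac dF; pose N q := (q.1 - c1) ^+ 2 + (q.2 - c2) ^+ 2.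
rewrite -/(N _) => AD AF p Ap Np.
have cN : continuous N.
  move=> q; apply: cvgD; apply: cvg_sqr.
    exact: (cvgB cvg_fst (cvg_cst c1)).
  exact: (cvgB cvg_snd (cvg_cst c2)).
pose K := A @^-1` [set x | 0 <= x] `&` N @^-1` [set x | x <= r ^+ 2].
have KD q : K q -> D (cart q) by case=> h1 h2; exact: AD.
have Kp : K p by split => //; exact: ltW.
have cK : compact K.
  apply: (@subclosed_compact _ _ (`[c1 - r, c1 + r] `*` `[c2 - r, c2 + r])).
  - by apply: closedI; apply: preimage_closed.
  - by apply: compact_setX; exact: segment_compact.
  move=> q [_ /= Nq]; rewrite !in_itv/= -!ler_distl.
  have aux (u : R) : u ^+ 2 <= N q -> `|u| <= r.
    move=> uN; rewrite -(ler_pXn2r (_ : 0 < 2)%N) ?nnegrE ?(ltW r0)//.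
    by rewrite real_normK ?num_real// (le_trans uN).
  by split; apply: aux; rewrite /N ?lerDl ?lerDr sqr_ge0.
have [M [M0 HM]] : exists M : R, 0 <= M /\
    forall q, K q -> normc (F (cart q)) <= M.
  have [c1' c2'] := continuous_on_re_im dF KD.
  have cu : {within K, continuous
      (fun q => `|re_of F q.1 q.2| + `|im_of F q.1 q.2|)}.
    apply: continuous_in_subspaceT => q Kq.
    by apply: cvgD; apply: cvg_norm; [exact: c1'|exact: c2'].
  have [b _ bmax] := compact_EVT_max (ex_intro _ p Kp) cK cu.
  exists (`|re_of F b.1 b.2| + `|im_of F b.1 b.2|); split; first by rewrite addr_ge0.
  move=> q Kq; rewrite (le_trans _ (bmax q (mem_set Kq)))//.
  rewrite -[X in normc X]cart_eta (le_trans (normc_le _ _))//.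
pose c := cart (c1, c2).
(* The pole c is removed from the domain; K avoids it because A is negative there. *)
pose D' := D `&` [set z | z != c].
have dI : twice_derivable D' (fun z => (z - c)^-1).
  by apply: twice_derivable_inv => -[_ /eqP].
have dF' : twice_derivable D' F.
  by case: dF => f Ff df; exists f => z [Dz _]; [exact: Ff|exact: df].
have neqc q : 0 <= A q -> cart q != c.
  move=> Aq; apply/eqP => qc.
  have E : q = (c1, c2) by case: q qc {Aq} => ? ? [-> ->].
  by move: Ac; rewrite -E ltNge Aq.
have Nsqrt q : normc (cart q - c) = Num.sqrt (N q) by [].
have Npos q : 0 <= A q -> 0 < Num.sqrt (N q).
  move=> /neqc qc; rewrite -Nsqrt lt0r normc_ge0 andbT.
  by apply/eqP => /eq0_normc/subr0_eq qc'; move/eqP: qc.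
have key k q : K q -> normc (F (cart q)) * (r / Num.sqrt (N q)) ^+ k <= M.
  pose G := F * (cst r%:C%C * (fun z => (z - c)^-1)) ^+ k.
  have dG : twice_derivable D' G.
    apply: twice_derivableM => //; apply: twice_derivableX.
    by apply: twice_derivableM => //; exact: twice_derivable_cst.
  have GE q' : normc (G (cart q')) =
      normc (F (cart q')) * (r / Num.sqrt (N q')) ^+ k.
    rewrite /G fctE normcM; congr (_ * _); rewrite -Nsqrt !fctE.
    elim: k {G dG} => [|k IH]; first by rewrite !expr0 normc1.
    rewrite !exprS normcM IH; congr (_ * _).
    by rewrite normcM normcV /= expr0n addr0 sqrtr_sqr gtr0_norm.
  rewrite -GE; apply: (max_principle M0 cK dG).
    by move=> q' Kq'; split; [exact: KD|apply: neqc; case: Kq'].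
  (* A non-interior point of K lies on A = 0, where F vanishes, or on the circle of radius r, where
     the additional factor has modulus 1. *)
  move=> q' [/= Aq' Nq'] Iq'; rewrite GE.
  have [Aq0|Aq0] := eqVneq (A q') 0; first by rewrite AF// normc0 mul0r.
  have {}Nq' : N q' = r ^+ 2.
    apply/eqP; rewrite eq_le Nq' leNgt; apply/negP => Nr; apply: Iq'.
    have : nbhs q' (A @^-1` [set x | 0 < x] `&` N @^-1` [set x | x < r ^+ 2]).
      apply: open_nbhs_nbhs; split.
        by apply: openI; apply: open_comp => //.
      by split => //=; rewrite lt_neqAle eq_sym Aq0.
    by apply: filterS => u [/= u1 u2]; split; exact: ltW.
  rewrite Nq' sqrtr_sqr gtr0_norm// divff ?gt_eqF// expr1n mulr1.
  by apply: HM; split => //=; rewrite Nq'.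
apply: eq0_normc; apply: (geometric_bounded (normc_ge0 _) _ (fun k => key k p Kp)).
rewrite ltr_pdivlMr ?Npos// mul1r -[ltRHS]gtr0_norm// -sqrtr_sqr ltr_sqrt//.
by rewrite exprn_gt0.
Qed.

End Barrier.

(** * Unique continuation in one variable *)

Section IdentityTheorem.
Variable R : realType.
Local Notation C := (cplx R).
Implicit Types (F f G : C -> C) (z c d : C) (x y r m e t s : R) (p q : R * R).
Implicit Types (D : set C).

Lemma is_derive_near0 F z d r : 0 < r -> is_derive z 1 F d ->
  (forall h : C, sq r h -> F (z + h) = 0) -> d = 0.
Proof.
move=> r0 dF F0; have zF : \near z, F z = cst (0 : C) z.
  exists r%:C%C; first by rewrite /= ltcR.
  move=> w /=; rewrite -normrN opprB normE ltcR => wz.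
  rewrite -[w](subrK z) addrC; apply: F0; split.
    exact: le_lt_trans (Re_le_normc _) wz.
  exact: le_lt_trans (Im_le_normc _) wz.
have := near_eq_derive (1 : C) zF; rewrite derive_cst => <-.
by case: dF => _ ->.
Qed.

Lemma zero_derivative_segment F f z h :
  (forall t, 0 <= t <= 1 ->
     is_derive (z + t%:C%C * h) 1 F (f (z + t%:C%C * h)) /\
     f (z + t%:C%C * h) = 0) ->
  F (z + h) = F z.
Proof.
move=> H; pose G w := F (z + w * h).
have dG t : 0 <= t <= 1 -> cderive G t%:C%C 0.
  move=> /H[/cderiveP dF f0]; rewrite f0 in dF => e e0.
  have h1 : 0 < normc h + 1 by rewrite ltr_wpDl// normc_ge0.
  have [r r0 Hr] := dF (e / (normc h + 1)) (divr_gt0 e0 h1).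
  exists (r / (normc h + 1)); first by rewrite divr_gt0.
  move=> w wr; have := Hr (w * h); rewrite !mul0r !subr0 normcM.
  rewrite /G mulrDl addrA => /(_ _)/le_trans; apply.
    rewrite (@le_lt_trans _ _ (normc w * (normc h + 1)))//.
      by rewrite ler_wpM2l ?normc_ge0// lerDl.
    by rewrite -ltr_pdivlMr.
  rewrite -mulrA ler_wpM2l ?(ltW e0)// mulrC -mulrA ler_piMr ?normc_ge0//.
  by rewrite ler_pdivrMr// mul1r lerDl.
have cE t : t%:C%C = cart (t, 0) by [].
have E (u : R -> R) : (forall t, 0 <= t <= 1 -> is_derive t 1 u (0 : R)) -> u 1 = u 0.
  move=> du; have [c [_ _]] := @MVT_oo R u (fun=> 0) 0 1 ltr01 du.
  by rewrite mul0r => /subr0_eq.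
have -> : F (z + h) = G 1%:C%C by rewrite /G mul1r.
have -> : F z = G 0%:C%C by rewrite /G mul0r addr0.
rewrite -[LHS]cart_eta -[RHS]cart_eta; congr (cart (_, _)).
  apply: (E (fun t => complex.Re (G t%:C%C))) => t /dG.
  by rewrite cE => /cderive_diff2[/diff2_x + _].
apply: (E (fun t => complex.Im (G t%:C%C))) => t /dG.
by rewrite cE => /cderive_diff2[_ /diff2_x].
Qed.

Lemma twice_derivable_primitive D F f a :
  (forall z, D z -> is_derive z 1 F (f z)) ->
  (forall z, D z -> derivable f z 1) ->
  (forall z, D z -> is_derive z 1 (F - cst a) (f z)) /\
  twice_derivable D (F - cst a).
Proof.
move=> dF df; have dFa z : D z -> is_derive z 1 (F - cst a) (f z).
  move=> /dF dz; have := is_deriveB dz (is_derive_cst a z (1 : C)).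
  by rewrite subr0.
by split => //; exists f.
Qed.

(** The primitive that vanishes at 0 vanishes on the real segment. The barrier with A = Im spreads
    these zeros to a neighbourhood of i, where differentiation gives f = 0. *)
Lemma vanish_off_axis f : (forall z, sq 8 z -> derivable f z 1) ->
  (forall x, `|x| < 8 -> f x%:C%C = 0) -> f (cart (0, 1)) = 0.
Proof.
move=> df f0.
have [||F HF] := @has_primitive R f 8 4 _ _ df => //.
  by lra.
have sq4 z : sq 4 z -> derivable f z 1 by move=> [? ?]; apply: df; split; lra.
have [dG ddG] := twice_derivable_primitive (F 0) HF sq4.
set G := F - _ in dG ddG.
have F0 x : `|x| < 4 -> G x%:C%C = 0.
  move=> x4; apply/eqP; rewrite /G !fctE subr_eq0 -[x%:C%C]add0r; apply/eqP.
  apply: (zero_derivative_segment (f := f)) => t /andP[t0 t1].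
  have tx : `|t * x| < 4.
    by rewrite normrM ger0_norm// (le_lt_trans _ x4)// ler_piMl.
  rewrite add0r -rmorphM/=; split; first by apply: HF; split; rewrite /= ?normr0.
  by apply: f0; rewrite (lt_trans tx)//; lra.
have bd (u v : R) : (u - 0) ^+ 2 + (v - -1) ^+ 2 <= 3 ^+ 2 -> 0 <= v ->
    `|u| < 4 /\ `|v| < 4.
  by move=> uv v0; rewrite !ltr_norml; split; apply/andP; split; nra.
(* The upper part of the disc of radius 3 around -i stays inside [sq 4], and it contains the square
   of half-width 1 / 2 around i. *)
have GZ q : 0 <= q.2 -> (q.1 - 0) ^+ 2 + (q.2 - -1) ^+ 2 < 3 ^+ 2 -> G (cart q) = 0.
  apply: (@barrier R (sq 4) G snd 0 (-1) 3) => //.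
  - by move=> x; exact: cvg_snd.
  - by rewrite /= ltrN10.
  - by move=> [u v] /= v0 uv; have [] := bd _ _ uv v0; split.
  move=> [u v] /= v0 uv; rewrite v0; apply: F0.
  by have [] := bd _ _ uv; rewrite ?v0.
apply: (@is_derive_near0 G (cart (0, 1)) _ (1 / 2)) => //.
  by apply: dG; split; rewrite /= ?normr0 ?normr1; lra.
move=> [u v] [/= u2 v2]; rewrite cartD; apply: GZ => /=.
  by move: v2; rewrite ltr_norml; lra.
by move: u2 v2; rewrite !ltr_norml => /andP[? ?] /andP[? ?]; nra.
Qed.

(** The radius r / 2 of the conclusion does not depend on e, which is what continuation along a path
    requires. The barrier is centred at 0 and A vanishes on the circle of radius e / 2, so the zeros
    spread outwards. *)
Lemma vanish_disc f (r e : R) : 0 < e -> e < r ->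
  (forall z, sq r z -> derivable f z 1) -> (forall z, sq e z -> f z = 0) ->
  forall z, normc z < r / 2 -> f z = 0.
Proof.
move=> e0 er df f0.
have r0 : 0 < r by apply: lt_trans er.
(* Any factor strictly between 1 / 2 and 1 serves: the primitive must live on a neighbourhood of the
   closed disc of radius r / 2. *)
have [||F HF] := @has_primitive R f r (3 / 4 * r) _ _ df; [lra|lra|].
have sq34 z : sq (3 / 4 * r) z -> derivable f z 1.
  by move=> [? ?]; apply: df; split; lra.
have [dG ddG] := twice_derivable_primitive (F 0) HF sq34.
set G := F - _ in dG ddG.
have G0 z : sq e z -> sq (3 / 4 * r) z -> G z = 0.
  move=> [z1 z2] [z3 z4]; apply/eqP; rewrite /G !fctE subr_eq0 -[z]add0r; apply/eqP.
  apply: (zero_derivative_segment (f := f)) => t /andP[t0 t1]; rewrite add0r.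
  have tz s : sq s z -> sq s (t%:C%C * z).
    have tu (u : R) : `|t * u| <= `|u| by rewrite normrM ger0_norm// ler_piMl.
    case: (z) => u v [/= us vs]; split; rewrite /= mul0r ?subr0 ?addr0.
      exact: le_lt_trans us.
    exact: le_lt_trans vs.
  by split; [apply: HF; exact: tz|apply: f0; exact: tz].
pose A q := q.1 ^+ 2 + q.2 ^+ 2 - (e / 2) ^+ 2.
have le_of_sq (u v : R) : 0 <= v -> u ^+ 2 <= v ^+ 2 -> `|u| <= v.
  by move=> v0 uv; rewrite -(ler_pXn2r (_ : 0 < 2)%N) ?nnegrE// real_normK ?num_real.
have bd (u v s : R) : 0 <= s -> u ^+ 2 + v ^+ 2 <= s ^+ 2 -> `|u| <= s /\ `|v| <= s.
  move=> s0 uv; split; apply: le_of_sq => //; rewrite (le_trans _ uv)//.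
    by rewrite lerDl sqr_ge0.
  by rewrite lerDr sqr_ge0.
have GZ q : 0 <= A q -> (q.1 - 0) ^+ 2 + (q.2 - 0) ^+ 2 < (r / 2) ^+ 2 -> G (cart
  q) = 0.
  apply: (@barrier R (sq (3 / 4 * r)) G A 0 0 (r / 2)); first by rewrite divr_gt0.
  - move=> u; apply: cvgB; last exact: cvg_cst.
    by apply: cvgD; apply: cvg_sqr; [exact: cvg_fst|exact: cvg_snd].
  - by rewrite /A /= expr0n !add0r oppr_lt0 exprn_gt0// divr_gt0.
  - exact: ddG.
  - move=> [u v] _ /=; rewrite !subr0 => /bd[|u1 v1]; first by rewrite divr_ge0// ltW.
    by split => /=; lra.
  move=> [u v] /= /subr0_eq uv; rewrite !subr0 => /bd[|u1 v1];
    first by rewrite divr_ge0// ltW.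
  have /bd[|u2 v2] : u ^+ 2 + v ^+ 2 <= (e / 2) ^+ 2 by rewrite uv.
    by rewrite divr_ge0// ltW.
  by apply: G0; split => /=; lra.
move=> z zr; apply: (@is_derive_near0 G z _ ((r / 2 - normc z) / 2)).
- by rewrite divr_gt0// subr_gt0.
- apply: dG; have h1 := Re_le_normc z; have h2 := Im_le_normc z; split; lra.
move=> h [h1 h2].
have zh : normc (z + h) < r / 2.
  have := le_normcD z h; have := normc_le (complex.Re h) (complex.Im h).
  by rewrite cart_eta; lra.
have zh1 := Re_le_normc (z + h); have zh2 := Im_le_normc (z + h).
have [Az|Az] := leP 0 (A (complex.Re (z + h), complex.Im (z + h))).
  rewrite -[z + h]cart_eta; apply: GZ => //=; rewrite !subr0.
  case: (z + h) zh => u v /=; rewrite -(ltr_pXn2r (_ : 0 < 2)%N) ?nnegrE ?sqrtr_ge0//.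
    by rewrite sqr_sqrtr// addr_ge0 ?sqr_ge0.
  by rewrite divr_ge0// ltW.
move: Az; rewrite /A subr_lt0 /= => /ltW/bd[|u1 v1]; first by rewrite divr_ge0// ltW.
by apply: G0; split => /=; lra.
Qed.

Lemma derivable_shift f z w :
  derivable f (z + w) 1 -> derivable (fun u => f (z + u)) w 1.
Proof.
move=> /derivableP/cderiveP df.
have : is_derive w 1 (fun u => f (z + u)) ('D_1 f (z + w)); last by case.
apply/cderiveP => e /df[r r0 Hr]; exists r => // h /Hr.
by rewrite addrA.
Qed.

(** From a parameter close enough to the supremum of the good ones, [vanish_disc] reaches past that
    supremum, since its radius is governed by the domain of f and not by the size of the known zero
    set. *)
Lemma vanish_path f :
  (forall t, 0 <= t <= 1 -> exists2 r : R, 0 < r &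
     forall z, sq r z -> derivable f (t%:C%C + z) 1) ->
  (exists2 r : R, 0 < r & forall z, sq r z -> f z = 0) -> f 1 = 0.
Proof.
move=> df [r0 r00 fr0].
pose S : set R := [set t | 0 <= t <= 1 /\ exists2 r : R, 0 < r &
  forall s, 0 <= s <= t -> forall z, sq r z -> f (s%:C%C + z) = 0].
have S0 : S 0.
  split; first by rewrite lexx ler01.
  exists r0 => // s; rewrite -eq_le => /eqP <- z; rewrite add0r; exact: fr0.
have Sup : has_sup S by split; [exists 0|exists 1 => t [/andP[]]].
have T0 : 0 <= sup S by apply: ub_le_sup => //; exact: Sup.2.
have T1 : sup S <= 1 by apply: ge_sup; [exists 0|move=> t [/andP[]]].
have [r rpos dr] := df (sup S) (introT andP (conj T0 T1)).
(* For t within r / 8 of the supremum, the square of half-width r / 2 around t lies in the domain,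
   so [vanish_disc] gives zeros up to distance r / 4. This covers the parameters up to t + r / 8,
   thickened by r / 16 in each coordinate. *)
have r8 : 0 < r / 8 by rewrite divr_gt0.
have [t [/andP[t0 t1] [e e0 fe]] tT] := sup_adherent r8 Sup.
have tS : t <= sup S.
  by apply: ub_le_sup; [exact: Sup.2|split; [rewrite t0|exists e]].
have far z : normc z < r / 4 -> f (t%:C%C + z) = 0.
  move=> zr; apply: (@vanish_disc (fun z => f (t%:C%C + z)) (r / 2)
    (Num.min e (r / 4))) => //.
  - by rewrite lt_min e0 divr_gt0.
  - by rewrite gt_min; apply/orP; right; lra.
  - move=> w [w1 w2]; apply: derivable_shift.
    have -> : t%:C%C + w = (sup S)%:C%C + ((t - sup S)%:C%C + w).
      by rewrite addrA -rmorphD/= addrCA subrr addr0.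
    apply: dr; case: w w1 w2 => u v /= u1 v1; split; rewrite /= ?add0r; last by lra.
    have tS0 : `|t - sup S| < r / 8 by rewrite ltr_norml; lra.
    by rewrite (le_lt_trans (ler_normD _ _))//; lra.
  - move=> w [w1 w2]; apply: fe; first by rewrite t0 lexx.
    by move: w1 w2; rewrite !lt_min => /andP[? _] /andP[? _]; split.
  - by rewrite (lt_le_trans zr)//; lra.
have ext s z : 0 <= s <= t + r / 8 -> sq (Num.min e (r / 16)) z -> f (s%:C%C + z) = 0.
  move=> /andP[s0 str] [z1 z2].
  have [st|ts] := leP s t.
    apply: fe; first by rewrite s0.
    by move: z1 z2; rewrite !lt_min => /andP[? _] /andP[? _]; split.
  have -> : s%:C%C + z = t%:C%C + ((s - t)%:C%C + z).
    by rewrite addrA -rmorphD/= addrCA subrr addr0.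
  apply: far; rewrite (le_lt_trans (le_normcD _ _))//.
  have := normc_le (complex.Re z) (complex.Im z); rewrite cart_eta.
  have -> : normc (s - t)%:C%C = s - t.
    by rewrite /= expr0n addr0 sqrtr_sqr ger0_norm// subr_ge0 ltW.
  by move: z1 z2; rewrite !lt_min => /andP[_ z1] /andP[_ z2]; lra.
have e16 : 0 < Num.min e (r / 16) by rewrite lt_min e0 divr_gt0.
have [t81|t81] := leP 1 (t + r / 8).
  rewrite -[1]addr0 -[X in f (X + _)]/(1%:C%C); apply: ext.
    by rewrite ler01.
  by split; rewrite /= normr0.
have : t + r / 8 <= sup S.
  apply: ub_le_sup; first exact: Sup.2.
  split; first by apply/andP; split; lra.
  by exists (Num.min e (r / 16)) => // s sr z; exact: ext.
by move=> ?; exfalso; lra.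
Qed.

End IdentityTheorem.

(** * Homogeneous coordinates on the complexified reduced space *)

Local Open Scope quotient_scope.

Section Homogeneous.
Variables (R : realType) (n s : nat).
Local Notation C := (cplx R).
Local Notation V := 'rV[C]_n.+1.
Local Notation hatJ := (@hatJ R n s).
Local Notation hatM := (hatMred R n s).
Implicit Types (g : hatM -> C) (x : V * V) (xi eta rho : V).

Lemma hatJZ a b xi eta : hatJ (a *: xi, b *: eta) = a * b * hatJ (xi, eta).
Proof.
rewrite /Defs.hatJ mulr_sumr; apply: eq_bigr => k _ /=.
by rewrite !mxE; ring.
Qed.

Lemma hatJ_norm x : hatJ x != 0 -> hatZ s ((hatJ x)^-1 *: x.1, x.2).
Proof.
move=> x0; rewrite /hatZ /= -[x.2]scale1r hatJZ mulr1 -surjective_pairing.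
by rewrite mulVf.
Qed.

Definition hom_pt x (x0 : hatJ x != 0) : hatZ s :=
  exist (fun y => y \in hatZ s) _ (mem_set (hatJ_norm x0)).

Lemma hatMred_of_homE x (x0 : hatJ x != 0) :
  hatMred_of_hom s x = Some (\pi_hatM (hom_pt x0)).
Proof.
rewrite /hatMred_of_hom; case: insubP => [u _ uE|/negP[]].
  by congr (Some (\pi _)); apply: val_inj; rewrite uE.
exact/mem_set/hatJ_norm.
Qed.

Lemma hatMred_of_hom0 x : hatJ x = 0 -> hatMred_of_hom s x = None.
Proof.
(* As 0^-1 = 0, the rescaled pair has hatJ = 0 and not 1, so [insub] fails. *)
move=> x0; rewrite /hatMred_of_hom insubF//; apply/negP; rewrite inE /hatZ/=.
rewrite x0 invr0 -[x.2]scale1r hatJZ !mul0r => /eqP.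
by rewrite eq_sym oner_eq0.
Qed.

Lemma pi_hatM_eq (x y : hatZ s) (a : C) : a != 0 ->
  \val y = (a *: (\val x).1, a^-1 *: (\val x).2) -> \pi_hatM x = \pi_hatM y.
Proof. by move=> a0 yE; apply/eqmodP/asboolP; exists a. Qed.

(** g in homogeneous coordinates, with dummy value 0 where hatJ = 0. In this form g can be
    restricted to complex lines that leave [hatZ] and pass from one affine chart to another. *)
Definition hom_ext g x : C := oapp g 0 (hatMred_of_hom s x).

Lemma hom_extZ g a b xi eta : a != 0 -> b != 0 ->
  hom_ext g (a *: xi, b *: eta) = hom_ext g (xi, eta).
Proof.
move=> a0 b0; rewrite /hom_ext; have [x0|x0] := eqVneq (hatJ (xi, eta)) 0.
  by rewrite !hatMred_of_hom0// hatJZ x0 mulr0.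
have y0 : hatJ (a *: xi, b *: eta) != 0 by rewrite hatJZ !mulf_neq0.
rewrite (hatMred_of_homE x0) (hatMred_of_homE y0) /=; congr (g _); apply/esym.
apply: (@pi_hatM_eq _ _ b^-1); rewrite ?invr_eq0//= invrK.
rewrite hatJZ !scalerA; congr (_ *: _, _); rewrite !invfM.
by rewrite mulrC mulrA mulrA mulfV// mul1r mulrC.
Qed.

Lemma hom_ext_pi g (x : hatZ s) : hom_ext g (\val x) = g (\pi_hatM x).
Proof.
have x1 : hatJ (\val x) = 1 by have := valP x; rewrite inE.
have x0 : hatJ (\val x) != 0 by rewrite x1 oner_eq0.
rewrite /hom_ext (hatMred_of_homE x0) /=; congr (g (\pi _)); apply: val_inj => /=.
by rewrite x1 invr1 scale1r -surjective_pairing.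
Qed.

Lemma differentiable_row (U : normedModType C) m (f : U -> 'rV[C]_m) u :
  (forall k, differentiable (fun w => f w ord0 k) u) -> differentiable f u.
Proof.
move=> df; have -> : f = \sum_(k < m) (fun w => f w ord0 k *: delta_mx ord0 k).
  apply/funext => w; rewrite [LHS]row_sum_delta fct_sumE.
  by apply: eq_bigr.
by apply: differentiable_sum => k; exact: differentiableZl.
Qed.

Lemma neq0_coord xi eta : hatJ (xi, eta) != 0 ->
  (exists i, xi ord0 i != 0) /\ exists j, eta ord0 j != 0.
Proof.
move=> x0; split; apply: contrapT => H; move/negP: x0; apply; apply/eqP;
    apply: big1 => k _ /=.
  suff -> : xi ord0 k = 0 by rewrite mulr0 mul0r.
  by apply: contrapT => /eqP k0; apply: H; exists k.
suff -> : eta ord0 k = 0 by rewrite mulr0.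
by apply: contrapT => /eqP k0; apply: H; exists k.
Qed.

Definition chart_coord (i : 'I_n.+1) xi : 'rV[C]_n :=
  \row_k (xi ord0 (lift i k) / xi ord0 i).

Lemma affine_chart_coord i xi : xi ord0 i != 0 ->
  affine i (chart_coord i xi) = (xi ord0 i)^-1 *: xi.
Proof.
move=> xi0; apply/rowP => k; rewrite !mxE.
by case: unliftP => [k'|] -> /=; rewrite ?mxE mulrC// mulfV.
Qed.

(** Some coordinate of a u and some coordinate of b u is nonzero. Dividing by them near u changes
    nothing by homogeneity and brings the pair into an affine chart, where g is differentiable. *)
Lemma hom_ext_differentiable (U : normedModType C) g (a b : U -> V) u :
  holomorphic g ->
  (forall k, differentiable (fun w => a w ord0 k) u) ->
  (forall k, differentiable (fun w => b w ord0 k) u) ->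
  hatJ (a u, b u) != 0 -> differentiable (fun w => hom_ext g (a w, b w)) u.
Proof.
move=> hg da db /[dup] J0 /neq0_coord[[i ai] [j bj]].
have chart_diff (c : U -> V) l : (forall k, differentiable (fun w => c w ord0 k) u) ->
    c u ord0 l != 0 -> differentiable (fun w => chart_coord l (c w)) u.
  move=> dc cl; apply: differentiable_row => k.
  under eq_fun do rewrite mxE.
  by apply: differentiableM => //; exact: differentiableV.
have near0 (c : U -> V) l : (forall k, differentiable (fun w => c w ord0 k) u) ->
    c u ord0 l != 0 -> \near u, c u ord0 l != 0.
  by move=> dc cl; exact: (cvgr_neq0 _ (differentiable_continuous (dc l))).
apply: (@near_eq_differentiable _ _ _
  (fun w => in_chart i j g (chart_coord i (a w), chart_coord j (b w)))).
  apply: filterS2 (near0 a i da ai) (near0 b j db bj) => w aw bw.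
  rewrite /in_chart -/(hom_ext _ _) /= !affine_chart_coord//.
  by rewrite hom_extZ// invr_eq0.
apply: (@differentiable_comp _ _ _ _
  (fun w => (chart_coord i (a w), chart_coord j (b w))) (in_chart i j g)).
  by apply: differentiable_pair; exact: chart_diff.
apply: hg; rewrite /= !affine_chart_coord// hatJZ !mulf_neq0// invr_eq0//.
Qed.

End Homogeneous.

(** * Uniqueness of holomorphic extensions *)

Section Identity.
Variables (R : realType) (n s : nat).
Hypothesis s1 : (1 <= s)%N.
Local Notation C := (cplx R).
Local Notation V := 'rV[C]_n.+1.
Local Notation hatJ := (@hatJ R n s).
Local Notation J := (@J R n s).
Local Notation hatM := (hatMred R n s).
Local Notation conj_row := (map_mx (@Num.conj C)).
Implicit Types (g : hatM -> C) (x : V * V) (xi eta rho : V).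

(** The base point of the continuation: 1 <= s makes the sign of the coordinate 0 positive, so that
    e0 lies in [Z]. For s = 0 the form J has no positive values and the reduced space would be
    empty. *)
Let e0 : V := delta_mx ord0 ord0.

Lemma nu_norm (k : 'I_n.+1) : `|nu R s k| = 1.
Proof. by rewrite /nu; case: ifP => _; rewrite ?normrN normr1. Qed.

Lemma nu_conj (k : 'I_n.+1) : Num.conj (nu R s k) = nu R s k.
Proof. by rewrite /nu; case: ifP => _; rewrite ?rmorphN rmorph1. Qed.

Lemma hatJ_conj rho : hatJ (rho, conj_row rho) = J rho.
Proof. by apply: eq_bigr => k _; rewrite mxE. Qed.

Lemma J_real rho : complex.Im (J rho) = 0.
Proof.
suff : J rho \is Num.real by move=> /RIm_real/complexI.
rewrite CrealE rmorph_sum; apply/eqP; apply: eq_bigr => k _.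
by rewrite !rmorphM/= nu_conj conjCK -!mulrA [_ * rho _ _]mulrC.
Qed.

Lemma hatJ_e0l eta : hatJ (e0, eta) = eta ord0 ord0.
Proof.
rewrite /Defs.hatJ (bigD1 ord0)//= big1 ?addr0 => [|k k0].
  by rewrite mxE !eqxx /= mulr1 /nu s1 mul1r.
by rewrite mxE (negbTE k0) andbF mulr0 mul0r.
Qed.

Lemma hatJ_e0r xi : hatJ (xi, e0) = xi ord0 ord0.
Proof.
rewrite /Defs.hatJ (bigD1 ord0)//= big1 ?addr0 => [|k k0].
  by rewrite mxE !eqxx /= mulr1 /nu s1 mul1r.
by rewrite mxE (negbTE k0) andbF mulr0.
Qed.

Lemma hatJDl xi xi' eta : hatJ (xi + xi', eta) = hatJ (xi, eta) + hatJ (xi', eta).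
Proof.
by rewrite -big_split; apply: eq_bigr => k _ /=; rewrite mxE; ring.
Qed.

Lemma hatJDr xi eta eta' : hatJ (xi, eta + eta') = hatJ (xi, eta) + hatJ (xi, eta').
Proof.
by rewrite -big_split; apply: eq_bigr => k _ /=; rewrite mxE; ring.
Qed.

Lemma hatJ_near_e0 : exists2 eps : C, 0 < eps & forall xi eta,
  (forall k, `|(xi - e0) ord0 k| <= eps) ->
  (forall k, `|(eta - e0) ord0 k| <= eps) -> `|hatJ (xi, eta) - 1| < 1.
Proof.
pose N : C := n.+1%:R; have N1 : 1 <= N by rewrite ler1n.
have N0 : 0 < N by rewrite ltr0n.
(* Expanding around e0 leaves two linear terms and one quadratic term with N summands; each of the
   three is at most N * eps = 1 / 4. *)
exists (4 * N)^-1; first by rewrite invr_gt0 mulr_gt0.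
set eps := _^-1; have eps0 : 0 < eps by rewrite invr_gt0 mulr_gt0.
have Ne : N * eps = 4^-1 by rewrite /eps; field; rewrite gt_eqF.
have eps4 : eps <= 4^-1 by rewrite -Ne ler_peMl// ltW.
have eps1 : eps <= 1 by rewrite (le_trans eps4)// invf_le1// ler1n.
have sum4 : 4^-1 + 4^-1 + 4^-1 + 4^-1 = 1 :> C by field.
move=> xi eta.
rewrite -{2}[xi](subrK e0) -{2}[eta](subrK e0).
move: (xi - e0) (eta - e0) => {xi eta} u v hu hv.
rewrite hatJDl !hatJDr hatJ_e0r hatJ_e0l hatJ_e0l mxE !eqxx/= addrA addrK.
have huv : `|hatJ (u, v)| <= 4^-1.
  rewrite (le_trans (ler_norm_sum _ _ _))// -Ne.
  have -> : N * eps = \sum_(k < n.+1) eps by rewrite sumr_const card_ord mulr_natl.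
  apply: ler_sum => k _ /=; rewrite !normrM nu_norm mul1r.
  by rewrite -[leRHS]mul1r ler_pM// (le_trans (hu k)).
apply: (@le_lt_trans _ _ (4^-1 + 4^-1 + 4^-1)); last first.
  by rewrite -[ltRHS]sum4 ltrDl invr_gt0.
rewrite (le_trans (ler_normD _ _))// lerD//; last by rewrite (le_trans (hv _)).
by rewrite (le_trans (ler_normD _ _))// lerD// (le_trans (hu _)).
Qed.

(** The factor (J rho)^(-1/2) moves rho into [Z]; being real, it commutes with the conjugation in
    the second component. *)
Lemma zero_real g rho : g \o @Delta R n s = (fun=> 0) -> 0 < J rho ->
  hom_ext g (rho, conj_row rho) = 0.
Proof.
move=> g0 Jpos; pose c : C := (sqrtC (J rho))^-1.
have sJ : 0 < sqrtC (J rho) by rewrite sqrtC_gt0.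
have c0 : c != 0 by rewrite invr_eq0 gt_eqF.
have cc : Num.conj c = c.
  by apply/CrealP; rewrite realV gtr0_real.
have cE : conj_row (c *: rho) = c *: conj_row rho.
  by apply/rowP => k; rewrite !mxE rmorphM/= cc.
rewrite -(@hom_extZ _ _ _ g c c)//.
have zZ : Z s (c *: rho).
  rewrite /Z /= -hatJ_conj cE hatJZ hatJ_conj /c -expr2 exprVn sqrtCK.
  by rewrite mulVf// gt_eqF.
pose z : Z s := exist (fun y => y \in Z s) _ (mem_set zZ).
have -> : (c *: rho, c *: conj_row rho) = \val (conj_pair z).
  by rewrite /= cE.
rewrite hom_ext_pi -Delta_pi.
by rewrite -[LHS]/((g \o @Delta R n s) _) g0.
Qed.

Lemma sq_norm (z : C) r : sq r z -> `|z| < (2 * r)%:C%C.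
Proof.
move=> [h1 h2]; rewrite normE ltcR -[z]cart_eta.
by rewrite (le_lt_trans (normc_le _ _))// mulr_natl mulr2n ltrD.
Qed.

Lemma J_gt0 rho : `|J rho - 1| < 1 -> 0 < J rho.
Proof.
rewrite normE ltcR => J1; rewrite ltcE J_real eqxx /=.
have := le_lt_trans (Re_le_normc (J rho - 1)) J1.
by rewrite raddfB /= ltr_norml ltrBrDr addNr => /andP[].
Qed.

Lemma differentiable_line (P Q : V) k (z : C) :
  differentiable (fun w : C => (P + w *: Q) ord0 k) z.
Proof.
under eq_fun do rewrite mxE [X in _ + X]mxE.
apply: differentiableD; first exact: differentiable_cst.
by apply: differentiableM;
  [exact/derivable1_diffP/derivable_id|exact: differentiable_cst].
Qed.

(* [(xi, eta)] is the value at [z = i] of the complex line [(P + z Q, P^* + z Q^* )]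
   with [P = (xi + eta^* ) / 2] and [Q = (xi - eta^* ) / 2i], whose points with [z]
   real lie over [Mred]. *)
Lemma zero_near_e0 g (d1 d2 : V) : holomorphic g ->
  g \o @Delta R n s = (fun=> 0) ->
  exists2 r : R, 0 < r &
    forall z, sq r z -> hom_ext g (e0 + z *: d1, e0 + z *: d2) = 0.
Proof.
move=> hg g0; have [eps eps0 Heps] := hatJ_near_e0.
pose B : C := \sum_k (`|d1 ord0 k| + `|d2 ord0 k|) + 1.
have B0 : 0 < B by rewrite ltr_wpDl//; apply: sumr_ge0 => k _; exact: addr_ge0.
have HB k : `|d1 ord0 k| + `|d2 ord0 k| <= B.
  have S0 : 0 <= \sum_(l < n.+1 | l != k) (`|d1 ord0 l| + `|d2 ord0 l|).
    by apply: sumr_ge0 => l _; exact: addr_ge0.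
  by rewrite /B (bigD1 k)//= -addrA lerDl addr_ge0.
(* On [sq 8] one has |z| <= 16, so the line deviates from e0 by at most (1 / 2 + 16 / 2) * |l| * B.
   With |l| * B <= eps / 34 this is at most eps / 4. *)
pose r : R := complex.Re (eps / (34 * B)).
have rE : eps / (34 * B) = r%:C%C.
  by rewrite RRe_real// gtr0_real// divr_gt0// mulr_gt0.
have r0 : 0 < r by rewrite -ltcR -rE divr_gt0// mulr_gt0.
exists (r / 2) => [|l lr]; first by rewrite divr_gt0.
have {}lr : `|l| < eps / (34 * B).
  by have := sq_norm lr; rewrite rE; congr (_ < _%:C%C); field.
pose ii : C := cart (0, 1).
have ii2 : ii * ii = -1 by apply/eqP; rewrite eq_complex /= ; apply/andP; split;
  apply/eqP; ring.
have ii0 : ii != 0.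
  by apply/eqP => ii0; move/eqP: ii2; rewrite ii0 mul0r eq_sym oppr_eq0 oner_eq0.
have iiN : `|ii| = 1 by rewrite normE /= expr0n expr1n add0r sqrtr1.
have iic : Num.conj ii = - ii by apply/eqP; rewrite eq_complex /= oppr0 !eqxx.
pose xi := e0 + l *: d1; pose eta := e0 + l *: d2.
pose P : V := 2^-1 *: (xi + conj_row eta).
pose Q : V := (2 * ii)^-1 *: (xi - conj_row eta).
have e0c k : Num.conj (e0 ord0 k) = e0 ord0 k by rewrite mxE rmorph_nat.
pose a k := l * d1 ord0 k; pose b k := Num.conj (l * d2 ord0 k).
have Pk k : P ord0 k = e0 ord0 k + (a k + b k) / 2.
  by rewrite !mxE rmorphD/= rmorph_nat -/(b k) -/(a k); field.
have Qk k : Q ord0 k = (a k - b k) / (2 * ii).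
  by rewrite !mxE rmorphD/= rmorph_nat -/(b k) -/(a k); field; rewrite ii0.
have conj2 : Num.conj (2 : C) = 2 by rewrite rmorph_nat.
have Pck k : conj_row P ord0 k =
    e0 ord0 k + (Num.conj (a k) + Num.conj (b k)) / 2.
  by rewrite mxE Pk rmorphD/= e0c fmorph_div/= conj2 rmorphD.
have Qck k : conj_row Q ord0 k =
    (Num.conj (a k) - Num.conj (b k)) / (- (2 * ii)).
  by rewrite mxE Qk fmorph_div/= rmorphM/= conj2 iic mulrN rmorphB.
clearbody P Q.
have rowE (A D : V) z k : (A + z *: D - e0) ord0 k =
    A ord0 k + z * D ord0 k - e0 ord0 k by rewrite !mxE.
have bE (A D : C) z k : e0 ord0 k + A + z * D - e0 ord0 k = A + z * D by ring.
have bound (u v z w : C) : `|u| + `|v| <= `|l| * B -> `|z| <= 16 -> `|w| = 2 ->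
    `|(u + v) / 2 + z * ((u - v) / w)| <= eps.
  move=> uv z16 w2.
  have lB : `|l| * B <= eps / 34.
    rewrite -(ler_pM2r (_ : 0 < B^-1)) ?invr_gt0// mulfK ?gt_eqF//.
    by rewrite -mulrA -invfM ltW.
  have {}uv := le_trans uv lB.
  have e34 : 17 * (eps / 34) / 2 <= eps.
    have -> : 17 * (eps / 34) / 2 = eps / 4 by field.
    by rewrite ler_piMr ?(ltW eps0)// invf_le1// ler1n.
  apply: le_trans e34; apply: (@le_trans _ _ (eps / 34 / 2 + 16 * (eps / 34 / 2))).
    rewrite (le_trans (ler_normD _ _))// lerD//.
      by rewrite normrM normfV normr_nat ler_wpM2r// (le_trans (ler_normD _ _)).
    rewrite !normrM normfV w2 ler_pM// ?mulr_ge0//.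
    by rewrite ler_wpM2r// (le_trans (ler_normB _ _)).
  by rewrite le_eqVlt; apply/orP; left; apply/eqP; field.
have ab k : `|a k| + `|b k| <= `|l| * B.
  by rewrite norm_conjC !normrM -mulrDr ler_wpM2l.
have ii2N : `|2 * ii| = 2 by rewrite normrM normr_nat iiN mulr1.
have J1 z : sq 8 z -> `|hatJ (P + z *: Q, conj_row P + z *: conj_row Q) - 1| < 1.
  move=> /sq_norm/ltW z8.
  have {}z8 : `|z| <= 16.
    by rewrite (le_trans z8)// -natrM rmorph_nat.
  apply: Heps => k; first by rewrite rowE Pk Qk bE bound.
  rewrite rowE Pck Qck bE; apply: bound => //; last by rewrite normrN.
  by rewrite (norm_conjC (a k)) (norm_conjC (b k)).
have J0 z : sq 8 z -> hatJ (P + z *: Q, conj_row P + z *: conj_row Q) != 0.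
  by move=> /J1; apply: contraTneq => ->; rewrite sub0r normrN normr1 ltxx.
pose f z := hom_ext g (P + z *: Q, conj_row P + z *: conj_row Q).
have fii : f ii = hom_ext g (xi, eta).
  have addrowE (A D : V) k : (A + ii *: D) ord0 k = A ord0 k + ii * D ord0 k.
    by rewrite !mxE.
  have xiE : P + ii *: Q = xi.
    apply/rowP => k; rewrite addrowE (_ : xi ord0 k = e0 ord0 k + a k);
      last by rewrite !mxE.
    by rewrite Pk Qk; field; rewrite ii0.
  have etaE : conj_row P + ii *: conj_row Q = eta.
    apply/rowP => k; rewrite addrowE.
    rewrite (_ : eta ord0 k = e0 ord0 k + Num.conj (b k));
      last by rewrite /b conjCK !mxE.
    by rewrite Pck Qck; field; rewrite ii0.
  by rewrite /f xiE etaE.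
rewrite -fii; apply: vanish_off_axis => [z z8|x x8].
  apply/derivable1_diffP; apply: hom_ext_differentiable => //.
  - by move=> k; exact: differentiable_line.
  - by move=> k; exact: differentiable_line.
  - exact: J0.
have xs : sq 8 (x%:C%C) by split; rewrite /= ?normr0.
have xE : conj_row P + x%:C%C *: conj_row Q = conj_row (P + x%:C%C *: Q).
  apply/rowP => k; rewrite !mxE rmorphD rmorphM/=; congr (_ + _ * _).
  by apply/eqP; rewrite eq_complex /= oppr0 !eqxx.
rewrite /f xE; apply: zero_real => //; apply: J_gt0.
by rewrite -hatJ_conj -xE; exact: J1.
Qed.

Lemma hatJ_line (d1 d2 : V) (z : C) :
  hatJ (e0 + z *: (d1 - e0), e0 + z *: (d2 - e0)) =
  (1 - z) ^+ 2 + z * (1 - z) * (hatJ (e0, d2) + hatJ (d1, e0))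
  + z ^+ 2 * hatJ (d1, d2).
Proof.
have lineE (d : V) : e0 + z *: (d - e0) = (1 - z) *: e0 + z *: d.
  by rewrite scalerBr scalerBl scale1r addrA addrAC.
rewrite !lineE hatJDl !hatJDr !hatJZ.
have -> : hatJ (e0, e0) = 1 by rewrite hatJ_e0l mxE !eqxx.
by ring.
Qed.

(** By [hatJ_line], the real part of hatJ along the segment from (e0, e0) to (d1, d2) is a sum of
    nonnegative terms, with a positive one for every t in [0, 1]. The segment thus stays in the
    domain and [vanish_path] applies. *)
Lemma hom_ext_eq0_pos g (d1 d2 : V) : holomorphic g ->
  g \o @Delta R n s = (fun=> 0) -> 0 < hatJ (d1, d2) ->
  0 <= complex.Re (hatJ (e0, d2) + hatJ (d1, e0)) ->
  hom_ext g (d1, d2) = 0.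
Proof.
move=> hg g0 Jpos cpos.
pose h (z : C) : C := hatJ (e0 + z *: (d1 - e0), e0 + z *: (d2 - e0)).
pose f (z : C) : C := hom_ext g (e0 + z *: (d1 - e0), e0 + z *: (d2 - e0)).
have -> : hom_ext g (d1, d2) = f 1 by rewrite /f !scale1r ![e0 + _]addrC !subrK.
have ht t : 0 <= t <= 1 -> h t%:C%C != 0.
  move=> /andP[t0 t1]; apply/eqP => /(congr1 (@complex.Re R)); rewrite /h hatJ_line.
  move: Jpos cpos; move: (hatJ (d1, d2)) (hatJ (e0, d2) + hatJ (d1, e0)) => [H
    H'] [c c'].
  rewrite ltcE => /andP[_ /=] H0 c0.
  move=> E; have : (1 - t) ^+ 2 + t * (1 - t) * c + t ^+ 2 * H = 0.
    by rewrite -E; ring.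
  apply/eqP; rewrite gt_eqF//.
  have tc : 0 <= t * (1 - t) * c by rewrite !mulr_ge0// subr_ge0.
  have [->|tn0] := eqVneq t 0; first by rewrite !mul0r expr0n mul0r; lra.
  have : 0 < t ^+ 2 * H by rewrite mulr_gt0// exprn_gt0// lt0r tn0.
  by have := sqr_ge0 (1 - t); lra.
apply: vanish_path => [t t01|]; last exact: zero_near_e0.
have dline (d : V) k z : differentiable (fun w : C => (e0 + w *: d) ord0 k) z.
  exact: differentiable_line.
have dh : differentiable h (t%:C%C : C).
  apply: sum_differentiable => k /=.
  apply: differentiableM => //; apply: differentiableM => //.
have [e /= epos He] : \forall w \near (t%:C%C : C), h w != 0.
  exact: (cvgr_neq0 _ (differentiable_continuous dh) (ht t t01)).
have eE : e = (complex.Re e)%:C%C by rewrite RRe_real// gtr0_real.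
exists (complex.Re e / 2) => [|z zr].
  by rewrite divr_gt0// -ltcR -eE.
have hz : h (t%:C%C + z) != 0.
  apply: He; rewrite /= opprD addNKr normrN eE.
  by have := sq_norm zr; rewrite mulrC divfK.
have := @hom_ext_differentiable R n s C g (fun w => e0 + w *: (d1 - e0))
  (fun w => e0 + w *: (d2 - e0)) (t%:C%C + z) hg
  (fun k => dline _ k _) (fun k => dline _ k _) hz.
by move/derivable1_diffP.
Qed.

(** Rescaling arranges both positivity conditions: the conjugate of hatJ (d1, d2) as a factor of d1
    makes hatJ positive, and changing the sign of both vectors keeps hatJ but reverses the mixed
    term. *)
Lemma hom_ext_eq0 g (d1 d2 : V) : holomorphic g ->
  g \o @Delta R n s = (fun=> 0) -> hatJ (d1, d2) != 0 -> hom_ext g (d1, d2) = 0.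
Proof.
move=> hg g0 J0; pose a := Num.conj (hatJ (d1, d2)).
have a0 : a != 0 by rewrite fmorph_eq0.
rewrite -(hom_extZ g d1 d2 a0 (oner_neq0 _)) scale1r.
have Ja : 0 < hatJ (a *: d1, d2).
  by rewrite -[d2]scale1r hatJZ mulr1 mulrC -normCK exprn_gt0 ?normr_gt0.
have [cpos|cneg] := leP 0 (complex.Re (hatJ (e0, d2) + hatJ (a *: d1, e0))).
  exact: hom_ext_eq0_pos.
have N1 : -1 != 0 :> C by rewrite oppr_eq0 oner_neq0.
rewrite -(hom_extZ g _ _ N1 N1); apply: hom_ext_eq0_pos => //.
  by rewrite hatJZ mulrNN !mul1r.
have -> : hatJ (e0, -1 *: d2) = - hatJ (e0, d2).
  by rewrite -{1}[e0]scale1r hatJZ mul1r mulN1r.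
have -> : hatJ (-1 *: (a *: d1), e0) = - hatJ (a *: d1, e0).
  by rewrite -{1}[e0]scale1r hatJZ mulr1 mulN1r.
by rewrite -opprD raddfN /= oppr_ge0 ltW.
Qed.

Lemma holomorphic_eq0 g : holomorphic g -> g \o @Delta R n s = (fun=> 0) ->
  g = (fun=> 0).
Proof.
move=> hg g0; apply/funext => y; rewrite -[y]reprK -hom_ext_pi.
have := valP (repr y); rewrite inE /hatZ; case: (\val _) => d1 d2 /= J1.
by apply: hom_ext_eq0 => //; rewrite J1 oner_neq0.
Qed.

Lemma holomorphic_ext_uniq g g' : holomorphic g -> holomorphic g' ->
  g \o @Delta R n s = g' \o @Delta R n s -> g = g'.
Proof.
move=> hg hg' gg.
have /holomorphic_eq0 H := holomorphic_lin (-1) hg' hg.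
apply/funext => y; have : (-1 *: g' + g) y = 0.
  rewrite H//; apply/funext => m; have := congr1 (@^~ m) gg.
  by rewrite /= !fctE scaleN1r => ->; rewrite addNr.
by rewrite !fctE scaleN1r addrC => /subr0_eq.
Qed.

End Identity.

(** * Change of signature *)

(** A compact set of M' has compact image in M, and uniform closeness on that image is uniform
    closeness of the composites. *)
Lemma precomp_continuous (M M' : topologicalType) (V : uniformType)
    (phi : M' -> M) : continuous phi ->
  continuous (fun f : {family compact, M -> V} =>
                (f \o phi : {family compact, M' -> V})).
Proof.
move=> phic f; apply/(@fam_cvgP M' V compact _ (f \o phi)).
  by rewrite nbhs_filterE; apply: fmap_filter; exact: nbhs_filter.
move=> A cA P /uniform_nbhs[E [entE EP]].
have cB : compact (phi @` A).
  by apply: continuous_compact => //; exact: continuous_subspaceT.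
rewrite nbhs_filterE.
have := fam_nbhs f entE cB; apply: filterS => h hE; apply: EP => y Ay.
by apply: hE; exists y.
Qed.

Section Transport.
Variables (R : realType) (n s s' : nat).
Local Notation C := (cplx R).
Local Notation V := 'rV[C]_n.+1.
Local Notation hatM := (hatMred R n s).
Local Notation hatM' := (hatMred R n s').
Implicit Types (g : hatM -> C) (xi eta rho : V).

Definition twist_sign (k : 'I_n.+1) : C := nu R s k * nu R s' k.

Definition twist eta : V := \row_k (twist_sign k * eta ord0 k).

Lemma twist_sign_sqr k : twist_sign k * twist_sign k = 1.
Proof.
by rewrite /twist_sign /nu; do 2 case: ifP => _; rewrite ?(mulrN1, mulr1, opprK).
Qed.

Lemma twistZ a eta : twist (a *: eta) = a *: twist eta.
Proof. by apply/rowP => k; rewrite !mxE mulrCA. Qed.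

Lemma hatJ_twist xi eta : hatJ s (xi, twist eta) = hatJ s' (xi, eta).
Proof.
apply: eq_bigr => k _ /=; rewrite mxE /twist_sign -[RHS]mul1r.
have -> : 1 = nu R s k * nu R s k by rewrite /nu; case: ifP; rewrite ?mulrNN mulr1.
by ring.
Qed.

Lemma twist_hatZ (x : hatZ (R := R) (n := n) s') :
  ((\val x).1, twist (\val x).2) \in hatZ s.
Proof.
have x1 : hatJ s' (\val x) = 1 by have := valP x; rewrite inE.
by rewrite inE /hatZ /= hatJ_twist -surjective_pairing.
Qed.

Definition twist_pt (x : hatZ (R := R) (n := n) s') : hatZ s :=
  exist (fun y => y \in hatZ s) _ (twist_hatZ x).

Definition twistM (y : hatM') : hatM := \pi_hatM (twist_pt (repr y)).

Lemma twistM_pi (x : hatZ (R := R) (n := n) s') :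
  twistM (\pi_hatM' x) = \pi_hatM (twist_pt x).
Proof.
have : x = repr (\pi_hatM' x) %[mod hatM'] by rewrite reprK.
move=> /eqmodP/asboolP[a a0 aE]; apply/esym; apply: (@pi_hatM_eq _ _ _ _ _ a) => //=.
by rewrite aE /= twistZ.
Qed.

Lemma twist_differentiable v : differentiable twist v.
Proof.
apply: differentiable_row => k; under eq_fun do rewrite mxE.
apply: differentiableM; first exact: differentiable_cst.
exact: differentiable_coord.
Qed.

Lemma twistM_continuous : continuous twistM.
Proof.
apply/quotient_continuous.
have -> : twistM \o \pi_hatM' = \pi_hatM \o twist_pt.
  by apply/funext => x; rewrite /= twistM_pi.
have tc : continuous twist_pt.
  apply/continuousP => _ [B oB <-].
  exists ((fun y : V * V => (y.1, twist y.2)) @^-1` B); last by [].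
  apply: open_comp => // y _.
  apply: differentiable_continuous.
  apply: differentiable_pair; first exact: fst_differentiable.
  apply: (@differentiable_comp _ _ _ _ snd twist).
    exact: snd_differentiable.
  exact: twist_differentiable.
by move=> x; apply: (@continuous_comp _ _ _ twist_pt \pi_hatM x (tc x));
  exact: pi_continuous.
Qed.

Lemma hom_ext_twist g xi eta :
  hom_ext (g \o twistM) (xi, eta) = hom_ext g (xi, twist eta).
Proof.
rewrite /hom_ext; have [x0|x0] := eqVneq (hatJ s' (xi, eta)) 0.
  by rewrite !hatMred_of_hom0// hatJ_twist.
have y0 : hatJ s (xi, twist eta) != 0 by rewrite hatJ_twist.
rewrite (hatMred_of_homE x0) (hatMred_of_homE y0) /= twistM_pi.
by congr (g (\pi _)); apply: val_inj; rewrite /= hatJ_twist.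
Qed.

(** The twist may turn the normalised coordinate 1 of an affine chart into -1, so the argument
    passes through homogeneous coordinates, where the twist is linear. *)
Lemma holomorphic_twist g : holomorphic g -> holomorphic (g \o twistM).
Proof.
move=> hg i j t t0.
have -> : in_chart i j (g \o twistM) =
    (fun t => hom_ext g (affine i t.1, twist (affine j t.2))).
  by apply/funext => u; rewrite -hom_ext_twist.
apply: hom_ext_differentiable => //.
- by move=> k; exact/affine_differentiable/fst_differentiable.
- move=> k; under eq_fun do rewrite mxE.
  apply: differentiableM; first exact: differentiable_cst.
  exact/affine_differentiable/snd_differentiable.
- by rewrite hatJ_twist.
Qed.

Lemma comp_twistM_continuous :
  continuous (fun f : {family compact, hatM -> C} =>
                (f \o twistM : {family compact, hatM' -> C})).
Proof. exact: precomp_continuous twistM_continuous. Qed.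

End Transport.

(** * The isomorphism *)

Lemma continuous_to_initial (S : choiceType) (T U : topologicalType) (f : S -> T)
    (h : U -> initial_topology f) : continuous (f \o h) -> continuous h.
Proof.
move=> /continuousP fh; apply/continuousP => _ [B oB <-].
exact: fh.
Qed.

Lemma continuous_comp_fun (S T U : topologicalType) (f : S -> T) (g : T -> U) :
  continuous f -> continuous g -> continuous (g \o f).
Proof. by move=> fc gc x; apply: continuous_comp; [exact: fc|exact: gc]. Qed.

(** * The chosen holomorphic extension of a function *)

Section Extension.
Variables (R : realType) (n s : nat).
Local Notation C := (cplx R).
Local Notation V := 'rV[C]_n.+1.
Local Notation hatM := (hatMred R n s).
Local Notation A := (algA R n s).
Implicit Types (f : A) (g : hatM -> C) (P Q : midx n).

Lemma extension_holomorphic f : holomorphic (extension f).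
Proof. by rewrite /extension; case: cid2. Qed.

Lemma extension_Delta f : alg_fun f = extension f \o @Delta R n s.
Proof. by rewrite /extension; case: cid2. Qed.

(** Neutralises the choice inside [extension]: exhibiting any holomorphic extension computes it. *)
Lemma extension_unique f g : (1 <= s)%N -> holomorphic g ->
  alg_fun f = g \o @Delta R n s -> extension f = g.
Proof.
move=> s1 hg fg; apply: (holomorphic_ext_uniq s1) => //.
  exact: extension_holomorphic.
by rewrite -extension_Delta.
Qed.

(** The extension of b_{P,Q}, with conj rho replaced by eta; for equal degrees it does not depend on
    the representative. *)
Definition mono_ext P Q (y : hatM) : C :=
  mono P (\val (repr y)).1 * mono Q (\val (repr y)).2.

Lemma mono_ext_pi P Q (x : hatZ s) : mdeg P = mdeg Q ->
  mono_ext P Q (\pi_hatM x) = mono P (\val x).1 * mono Q (\val x).2.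
Proof.
move=> PQ; rewrite /mono_ext.
have : x = repr (\pi_hatM x) %[mod hatM] by rewrite reprK.
move=> /eqmodP/asboolP[a a0 ->] /=; rewrite !monoZ PQ.
by rewrite mulrACA exprVn mulfV ?expf_neq0// mul1r.
Qed.

Lemma holomorphic_mono_ext P Q : mdeg P = mdeg Q -> holomorphic (mono_ext P Q).
Proof.
move=> PQ i j t t0.
pose G (x : V * V) : C := mono P x.1 * mono Q x.2.
have gG (x : hatZ s) : mono_ext P Q (\pi_hatM x) = G (\val x).
  exact: mono_ext_pi.
pose H (t : 'rV[C]_n * 'rV[C]_n) := hatJ s (affine i t.1, affine j t.2).
apply: (@near_eq_differentiable _ _ _
  (fun t => G ((H t)^-1 *: affine i t.1, affine j t.2))).
  apply: filterS (near_hatJ_neq0 t0) => u u0.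
  by rewrite (in_chart_near gG u0).
apply: differentiableM; apply: prod_differentiable => k /=;
    apply: pow_differentiable; last first.
  exact/affine_differentiable/snd_differentiable.
under eq_fun do rewrite mxE.
apply: differentiableM; last exact/affine_differentiable/fst_differentiable.
by apply: differentiableV => //; exact: hatJ_chart_differentiable.
Qed.

Lemma extension_alg_b P Q : (1 <= s)%N -> mdeg P = mdeg Q ->
  extension (alg_b R s P Q) = mono_ext P Q.
Proof.
move=> s1 PQ; apply: extension_unique => //; first exact: holomorphic_mono_ext.
rewrite alg_bE//; apply/funext => m; rewrite -[m]reprK /= Delta_pi mono_ext_pi//.
by rewrite bfun_pi// mono_conj.
Qed.

Lemma extension_one : (1 <= s)%N -> extension (@alg_one R n s) = cst 1.
Proof. by move=> s1; apply: extension_unique => //; exact: holomorphic_cst. Qed.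

Lemma extension_lin (a : C) f f' : (1 <= s)%N ->
  extension (a *: f + f') = a *: (extension f : hatM -> C) + extension f'.
Proof.
move=> s1; apply: extension_unique => //.
  by apply: holomorphic_lin; exact: extension_holomorphic.
apply/funext => m; have -> : alg_fun (a *: f + f') = a *: alg_fun f + alg_fun f'
  by [].
by rewrite !extension_Delta.
Qed.

Lemma extensionZ (a : C) f : (1 <= s)%N ->
  extension (a *: f) = a *: (extension f : hatM -> C).
Proof.
move=> s1; have e0 : extension (0 : A) = cst 0.
  by apply: extension_unique => //; exact: holomorphic_cst.
by have := extension_lin a f 0 s1; rewrite addr0 e0 addr0.
Qed.

Lemma algA_ext f f' : extension f = extension f' -> f = f'.
Proof. by move=> ff; apply: val_inj; rewrite /= !extension_Delta ff. Qed.

End Extension.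

(** * The linear homeomorphism induced by the twist *)

Section Transfer.
Variables (R : realType) (n s s' : nat).
Hypotheses (s1 : (1 <= s)%N) (s'1 : (1 <= s')%N).
Local Notation C := (cplx R).
Local Notation A := (algA R n s).
Local Notation A' := (algA R n s').
Local Notation hatM := (hatMred R n s).
Local Notation twistM := (@twistM R n s s').
Implicit Types (f : A) (P Q T : midx n).

Lemma transfer_subproof f :
  (extension f \o twistM \o @Delta R n s') \in @analytic R n s'.
Proof.
apply/analyticP; exists (extension f \o twistM) => //.
exact/holomorphic_twist/extension_holomorphic.
Qed.

Definition transfer f : A' := AlgA (transfer_subproof f).

Lemma extension_transfer f : extension (transfer f) = extension f \o twistM.
Proof.
apply: extension_unique => //.
exact/holomorphic_twist/extension_holomorphic.
Qed.

Lemma transfer_lin (a : C) f f' :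
  transfer (a *: f + f') = a *: transfer f + transfer f'.
Proof.
apply: algA_ext; rewrite extension_transfer !extension_lin// !extension_transfer.
by [].
Qed.

Lemma transfer_continuous : continuous transfer.
Proof.
apply: (@continuous_to_initial _ _ _ (@extension R n s') transfer).
have -> : @extension R n s' \o transfer =
    (fun g : hatM -> C => g \o twistM) \o @extension R n s.
  by apply/funext => f /=; rewrite extension_transfer.
apply: (continuous_comp_fun (@initial_continuous _ _ (@extension R n s))).
exact: comp_twistM_continuous.
Qed.

Lemma transfer_one : transfer alg_one = alg_one.
Proof. by apply: algA_ext; rewrite extension_transfer !extension_one. Qed.

Definition twist_coef Q : C := \prod_k twist_sign R s s' k ^+ Q k.

(** Only eta is twisted, hence only the exponent Q contributes a sign. *)
Lemma transfer_alg_b P Q : mdeg P = mdeg Q ->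
  transfer (alg_b R s P Q) = twist_coef Q *: alg_b R s' P Q.
Proof.
move=> PQ; apply: algA_ext; rewrite extension_transfer extension_alg_b//.
rewrite extensionZ// extension_alg_b//; apply/funext => y.
rewrite -[y]reprK /= twistM_pi !fctE !mono_ext_pi//= /GRing.scale/= mulrCA.
congr (_ * _); rewrite /mono /twist_coef -big_split; apply: eq_bigr => k _.
by rewrite mxE exprMn.
Qed.

End Transfer.

Section TwistInverse.
Variables (R : realType) (n s s' : nat).
Hypotheses (s1 : (1 <= s)%N) (s'1 : (1 <= s')%N).

Lemma twistMK : cancel (@twistM R n s' s) (@twistM R n s s').
Proof.
move=> y; have [x ->] : exists x, y = \pi_(hatMred R n s) x.
  by exists (repr y); rewrite reprK.
rewrite !twistM_pi; congr (\pi _); apply: val_inj => /=.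
rewrite [RHS]surjective_pairing; congr (_, _); apply/rowP => k; rewrite !mxE mulrA.
suff -> : twist_sign R s s' k * twist_sign R s' s k = 1 by rewrite mul1r.
by rewrite -(twist_sign_sqr R s s' k) /twist_sign [nu R s' k * _]mulrC.
Qed.

Lemma transferK : cancel (@transfer R n s s') (@transfer R n s' s).
Proof.
move=> f; apply: algA_ext; rewrite !extension_transfer//.
by apply/funext => y /=; rewrite twistMK.
Qed.

End TwistInverse.

Lemma continuous_pair_map (T U : topologicalType) (f : T -> U) :
  continuous f -> continuous (fun p : T * T => (f p.1, f p.2)).
Proof.
move=> fc [a b] P [[B1 B2] /= [n1 n2] BP].
exists (f @^-1` B1, f @^-1` B2) => /=; first by split; exact: fc.
by move=> [u v] [/= u1 v2]; apply: BP.
Qed.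

(** * Structure constants under the change of signature *)

Section StarTransfer.
Variables (R : realType) (n s s' : nat) (hbar : cplx R).
Hypotheses (s1 : (1 <= s)%N) (s'1 : (1 <= s')%N).
Local Notation C := (cplx R).
Local Notation A := (algA R n s).
Local Notation A' := (algA R n s').
Local Notation Phi := (@transfer R n s s').
Local Notation Psi := (@transfer R n s' s).
Implicit Types (f g : A) (P Q S T : midx n).

Definition transfer_linear : {linear A -> A'} :=
  HB.pack Phi (GRing.isLinear.Build C A A' *:%R Phi (transfer_lin s1 s'1)).

Lemma transferZ a f : Phi (a *: f) = a *: Phi f.
Proof. exact: (linearZ_LR transfer_linear). Qed.

Lemma transfer_sum (I : Type) (r : seq I) (pr : pred I) (F : I -> A) :
  Phi (\sum_(i <- r | pr i) F i) = \sum_(i <- r | pr i) Phi (F i).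
Proof. exact: (linear_sum transfer_linear). Qed.

Lemma polyA_transfer f : polyA f -> polyA (Phi f).
Proof.
move=> [r [rP ->]].
exists [seq (c.1 * twist_coef R s s' c.2.2, c.2) | c <- r]; split.
  by rewrite all_map.
rewrite transfer_sum big_map big_seq [RHS]big_seq; apply: eq_bigr => c cr /=.
by rewrite transferZ transfer_alg_b ?scalerA//; apply/eqP; exact: (allP rP).
Qed.

Lemma nu_sqr l (k : 'I_n.+1) : nu R l k * nu R l k = 1.
Proof. by rewrite /nu; case: ifP; rewrite ?mulrNN mulr1. Qed.

Lemma twist_coef_sqr Q : twist_coef R s s' Q * twist_coef R s s' Q = 1.
Proof.
rewrite /twist_coef -big_split big1// => k _ /=.
by rewrite -exprMn twist_sign_sqr expr1n.
Qed.

Lemma twist_coef_sgn T : sgn R s T * twist_coef R s s' T = sgn R s' T.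
Proof.
rewrite /sgn /twist_coef -big_split; apply: eq_bigr => k _ /=.
by rewrite -exprMn /twist_sign mulrA nu_sqr mul1r.
Qed.

Lemma twist_coef_add_sub Q S T : (forall k, T k <= Q k + S k)%N ->
  twist_coef R s s' (midx_sub (midx_add Q S) T) * twist_coef R s s' T =
  twist_coef R s s' Q * twist_coef R s s' S.
Proof.
move=> TQS; rewrite /twist_coef -!big_split; apply: eq_bigr => k _ /=.
by rewrite !ffunE -!exprD subnK.
Qed.

Lemma mdeg_add_sub P Q T : (forall k, T k <= P k + Q k)%N ->
  (mdeg (midx_sub (midx_add P Q) T) + mdeg T = mdeg P + mdeg Q)%N.
Proof.
move=> TPQ; rewrite /mdeg -!big_split; apply: eq_bigr => k _ /=.
by rewrite !ffunE subnK.
Qed.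

(** The term of index U acquires the sign eps^(Q+T-U). Multiplied by eps^Q * eps^T = eps^(Q+T-U) *
    eps^U it leaves eps^U, which converts the sign of U for s into that for s'. *)
Lemma transfer_star_b P Q S T : mdeg P = mdeg Q -> mdeg S = mdeg T ->
  (twist_coef R s s' Q * twist_coef R s s' T) *:
    Phi (star_b s hbar P Q S T) = star_b s' hbar P Q S T.
Proof.
move=> PQ ST; rewrite /star_b transfer_sum scaler_sumr; apply: eq_bigr => U _ /=.
set W := midx_of U.
have WQS k : (W k <= Q k)%N && (W k <= S k)%N.
  by have := ltn_ord (U k); rewrite ffunE ltnS leq_min.
have WQ k : (W k <= Q k + T k)%N.
  by have /andP[h _] := WQS k; rewrite (leq_trans h)// leq_addr.
have WS k : (W k <= P k + S k)%N.
  by have /andP[_ h] := WQS k; rewrite (leq_trans h)// leq_addl.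
(* Equal degrees keep [alg_b] away from its dummy value 0; they follow because the truncated
   subtractions are exact. *)
have deg : mdeg (midx_sub (midx_add P S) W) = mdeg (midx_sub (midx_add Q T) W).
  by apply/eqP; rewrite -(eqn_add2r (mdeg W)) !mdeg_add_sub// PQ ST.
rewrite transferZ transfer_alg_b// !scalerA; congr (_ *: _).
rewrite -twist_coef_sgn -(twist_coef_add_sub WQ).
set u := twist_coef R s s' (midx_sub _ _); set w := twist_coef R s s' W.
have u2 : u * u = 1 := twist_coef_sqr _.
by rewrite -[in RHS](mul1r (sgn R s W)) -u2; ring.
Qed.

End StarTransfer.

Section StarIsomorphism.
Variables (R : realType) (n : nat) (hbar : cplx R).
Local Notation C := (cplx R).

Lemma polyA0 s : polyA (0 : algA R n s).
Proof. by exists [::]; rewrite big_nil. Qed.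

Lemma polyA_alg_b s (P Q : midx n) : mdeg P = mdeg Q -> polyA (alg_b R s P Q).
Proof.
by move=> PQ; exists [:: (1, (P, Q))]; rewrite /= PQ eqxx big_seq1 scale1r.
Qed.

(** [is_star] gives bilinearity only on [polyA] and in the combined form c *: f + f', so the
    vanishing of op at 0 has to be extracted before homogeneity. *)
Lemma is_starZ s op (a b : C) (f g : algA R n s) : is_star hbar op ->
  polyA f -> polyA g -> polyA (b *: g) -> op (a *: f) (b *: g) = (a * b) *: op f g.
Proof.
move=> [opl opr _ _] pf pg pbg.
have op0l h : polyA h -> op 0 h = 0.
  move=> ph; have := opl 1 0 0 h (polyA0 s) (polyA0 s) ph.
  by rewrite !scale1r addr0 => /esym/eqP; rewrite -subr_eq0 addrK => /eqP.
have op0r h : polyA h -> op h 0 = 0.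
  move=> ph; have := opr 1 h 0 0 ph (polyA0 s) (polyA0 s).
  by rewrite !scale1r addr0 => /esym/eqP; rewrite -subr_eq0 addrK => /eqP.
have := opl a f 0 (b *: g) pf (polyA0 s) pbg.
rewrite addr0 op0l// addr0 => ->.
have := opr b f g 0 pf pg (polyA0 s).
by rewrite addr0 op0r// addr0 => ->; rewrite scalerA.
Qed.

Lemma polyAZ s (a : C) (f : algA R n s) : polyA f -> polyA (a *: f).
Proof.
move=> [r [rP ->]]; exists [seq (a * c.1, c.2) | c <- r]; split.
  by rewrite all_map.
by rewrite big_map scaler_sumr; apply: eq_bigr => c _; rewrite scalerA.
Qed.

(** Conjugation by the transfers preserves the defining properties. On generators, the signs picked
    up by the two arguments are those that [transfer_star_b] absorbs, as [twist_sign] is symmetric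
    in s and s'. *)
Lemma is_star_transfer s s' op : (1 <= s)%N -> (1 <= s')%N ->
  is_star hbar op ->
  is_star hbar (fun f g => @transfer R n s s' (op (transfer s f) (transfer s g))).
Proof.
move=> s1 s'1 /[dup] opP [opl opr opb opc]; split.
- move=> c f f' g pf pf' pg.
  rewrite transfer_lin// opl; try exact: polyA_transfer.
  by rewrite transfer_lin.
- move=> c f g g' pf pg pg'.
  rewrite transfer_lin// opr; try exact: polyA_transfer.
  by rewrite transfer_lin.
- move=> P Q S T PQ ST; rewrite !transfer_alg_b//.
  have pP := polyA_alg_b s PQ; have pS := polyA_alg_b s ST.
  rewrite (is_starZ _ opP pP pS (polyAZ _ pS)) opb// transferZ//.
  rewrite -(transfer_star_b hbar s1 s'1 PQ ST); congr (_ *: _).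
  by congr (_ * _); apply: eq_bigr => k _; rewrite /twist_sign mulrC.
pose u (fg : algA R n s' * algA R n s') := (transfer s fg.1, transfer s fg.2).
have cu : continuous u.
  by apply: continuous_pair_map; exact: transfer_continuous.
have c1 : continuous ((fun p : algA R n s * algA R n s => op p.1 p.2) \o u).
  by move=> fg; apply: continuous_comp; [exact: cu|exact: opc].
have ct : continuous (@transfer R n s s') by exact: transfer_continuous.
by move=> fg; apply: (@continuous_comp _ _ _ _ (@transfer R n s s') fg (c1 fg));
  exact: ct.
Qed.

Lemma transfer_star s s' (f g : algA R n s) : (1 <= s)%N -> (1 <= s')%N ->
  @transfer R n s s' (star hbar f g) = star hbar (transfer s' f) (transfer s' g).
Proof.
move=> s1 s'1; pose uniq l := [set op : algA R n l -> _ |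
  is_star hbar op /\ forall op', is_star hbar op' -> op' = op].
have move_uniq l l' op : (1 <= l)%N -> (1 <= l')%N -> uniq l op ->
    uniq l' (fun f g => @transfer R n l l' (op (transfer l f) (transfer l g))).
  move=> l1 l'1 [opP opU]; split; first exact: is_star_transfer.
  move=> op' /(is_star_transfer l'1 l1)/opU <-.
  by apply/funext => u; apply/funext => v; rewrite !transferK.
have [[op opP]|nop] := pselect (exists op, uniq s op).
  have op'P := move_uniq _ _ _ s1 s'1 opP.
  rewrite /star (xget_unique _ opP); last by move=> op1 [/opP.2].
  rewrite (xget_unique _ op'P); last by move=> op1 [/op'P.2].
  by rewrite !transferK.
(* Here both products take the default value 0: a unique extension on the other side could be
   transported back. *)
rewrite /star xgetPN; last by move=> op opP; apply: nop; exists op.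
rewrite xgetPN.
  exact: (linear0 (transfer_linear R n s1 s'1)).
move=> op opP; apply: nop;
  exists (fun f g => @transfer R n s' s (op (transfer s' f) (transfer s' g))).
exact: move_uniq.
Qed.

End StarIsomorphism.

Theorem mainTheorem4 (R : realType) (n : nat) (hn : (1 <= n)%N)
    (hbar : cplx R) (hhbar : forall k : nat, (1 <= k)%N -> hbar != k%:R^-1)
    (s s' : nat) (hs : (1 <= s <= 1 + n)%N) (hs' : (1 <= s' <= 1 + n)%N) :
  exists (Phi : {linear algA R n s -> algA R n s'})
         (Psi : algA R n s' -> algA R n s),
    [/\ cancel Phi Psi /\ cancel Psi Phi,
        Phi alg_one = alg_one,
        forall f g, Phi (star hbar f g) = star hbar (Phi f) (Phi g),
        continuous (Phi : algA R n s -> algA R n s') &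
        continuous Psi].
Proof.
have [s1 _] := andP hs; have [s'1 _] := andP hs'.
exists (transfer_linear R n s1 s'1), (@transfer R n s' s); split.
- by split; exact: transferK.
- exact: transfer_one.
- by move=> f g; exact: transfer_star.
- exact: transfer_continuous.
- exact: transfer_continuous.
Qed.
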